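(* For all positive integers $k,p,r$ with $p<2\lfloor\sqrt k\rfloor$, there exists a simple $k$-plane graph $G$ that has a unique minimum edge cut $T$, with $|T|=p$, such that for any two distinct edges $t_1,t_2\in T$ the corresponding subdivision vertices $\tilde t_1,\tilde t_2$ satisfy $d_F(\tilde t_1,\tilde t_2)\ge r$ in $\Lambda(\tilde G)$.
   Context: A drawing of a graph maps the vertices to distinct points of the plane and each edge to a curve (a homeomorphic image of $[0,1]$) joining the images of its endpoints whose interior contains no vertex. A crossing is a point interior to two distinct edges; no third edge passes through it, and the two edges cross transversally there. An embedded graph is a graph with such a drawing; it is $k$-plane if every edge contains at most $k$ crossing points and no two edge-curves share more than one point. The planarization $H^\times$ is obtained by inserting a dummy-vertex at every crossing point; $\Lambda(H)$ is obtained from $H^\times$ by inserting inside each face of $H^\times$ a face-vertex adjacent to all vertices of $H^\times$ on that face's boundary; the radial graph $R(H)$ is the subgraph of $\Lambda(H)$ formed by all edges incident to face-vertices; the face-distance $d_F(u,v)$ is the number of face-vertices on a shortest $u$–$v$ path in $R(H)$. $\tilde G$ is the embedded graph obtained from $G$ by subdividing every edge $t$ once by a vertex $\tilde t$ placed on the curve of $t$ between one endpoint and the first crossing point of $t$. An edge cut is a set of edges whose removal disconnects the graph; a minimum edge cut is one of minimum size. *)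

(* Defs.v *)
From HB Require Import structures.
From mathcomp Require Import all_boot all_order all_algebra.
From mathcomp Require Import all_classical all_reals all_analysis.
Set Implicit Arguments. Unset Strict Implicit. Unset Printing Implicit Defensive.
Import Order.TTheory GRing.Theory Num.Theory.
Import numFieldNormedType.Exports.
Local Open Scope classical_set_scope.
Local Open Scope ring_scope.

Definition nat_sqrt_floor (k : nat) : nat := (\max_(s < k.+1 | s * s <= k) s)%N.

Section Combinatorics.
Variables (n m : nat) (src tgt : 'I_m -> 'I_n).

Definition simple_graph : Prop :=
  (forall e, src e != tgt e) /\
  (forall e1 e2, ((src e1 == src e2) && (tgt e1 == tgt e2)) ||
                 ((src e1 == tgt e2) && (tgt e1 == src e2)) -> e1 = e2).

Definition adj_without (T : {set 'I_m}) : rel 'I_n :=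
  fun u v => [exists e, (e \notin T) &&
     (((src e == u) && (tgt e == v)) || ((src e == v) && (tgt e == u)))].

Definition is_edge_cut (T : {set 'I_m}) : Prop :=
  exists u v, ~~ connect (adj_without T) u v.

Definition is_min_edge_cut (T : {set 'I_m}) : Prop :=
  is_edge_cut T /\ forall T', is_edge_cut T' -> (#|T| <= #|T'|)%N.

Definition unique_min_edge_cut (T : {set 'I_m}) : Prop :=
  is_min_edge_cut T /\ forall T', is_min_edge_cut T' -> T' = T.

End Combinatorics.

Section Geometry.
Variable R : realType.
Definition pt := (R * R)%type.

Definition I01 : set R := [set t | 0 <= t <= 1].
Definition I01o : set R := [set t | 0 < t < 1].
Definition openSq : set pt := [set z | `|z.1| < 1 /\ `|z.2| < 1].

Variables (n m : nat) (src tgt : 'I_m -> 'I_n)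
          (pos : 'I_n -> pt) (curve : 'I_m -> R -> pt).

Definition img (e : 'I_m) : set pt := curve e @` I01.
Definition img_int (e : 'I_m) : set pt := curve e @` I01o.

Definition is_crossing (x : pt) : Prop :=
  exists e1 e2, e1 <> e2 /\ img_int e1 x /\ img_int e2 x.

Definition transversal_at (e1 e2 : 'I_m) (x : pt) : Prop :=
  exists (U : set pt) (phi psi : pt -> pt),
    open U /\ U x /\
    {within U, continuous phi} /\ {within openSq, continuous psi} /\
    phi @` U `<=` openSq /\ psi @` openSq `<=` U /\
    (forall y, U y -> psi (phi y) = y) /\
    (forall z, openSq z -> phi (psi z) = z) /\
    phi x = (0, 0) /\
    phi @` (U `&` img e1) = openSq `&` [set z | z.2 = 0] /\
    phi @` (U `&` img e2) = openSq `&` [set z | z.1 = 0].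

Definition is_drawing : Prop :=
  injective pos /\
  (forall e, {within I01, continuous curve e}) /\
  (forall e s t, I01 s -> I01 t -> curve e s = curve e t -> s = t) /\
  (forall e, curve e 0 = pos (src e) /\ curve e 1 = pos (tgt e)) /\
  (forall e v, ~ img_int e (pos v)) /\
  (forall e1 e2 x, e1 <> e2 -> img_int e1 x -> img_int e2 x ->
     (forall e3, e3 <> e1 -> e3 <> e2 -> ~ img e3 x) /\ transversal_at e1 e2 x).

Definition is_k_plane (k : nat) : Prop :=
  is_drawing /\
  (forall e, exists s : seq pt, (size s <= k)%N /\
      forall x, img_int e x -> is_crossing x -> x \in s) /\
  (forall e1 e2, e1 <> e2 -> forall x y,
      img e1 x -> img e2 x -> img e1 y -> img e2 y -> x = y).

Definition drawing_set : set pt :=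
  [set x | (exists v, x = pos v) \/ exists e, img e x].

Definition is_face (F : set pt) : Prop :=
  exists x, ~ drawing_set x /\ F = connected_component (~` drawing_set) x.

(* a valid choice of the subdivision vertices of tilde G: the vertex of e is
   curve e (sigma e), lying in the interior of e, between one endpoint and the
   first crossing point of e *)
Definition valid_subdivision (sigma : 'I_m -> R) : Prop :=
  forall e, I01o (sigma e) /\
    ((forall s, 0 <= s <= sigma e -> ~ is_crossing (curve e s)) \/
     (forall s, sigma e <= s <= 1 -> ~ is_crossing (curve e s))).

Definition tilde_vertices (sigma : 'I_m -> R) : set pt :=
  [set x | (exists v, x = pos v) \/ is_crossing x \/
           exists e, x = curve e (sigma e)].

Definition rnode := (pt + set pt)%type.

Definition radial_adj (sigma : 'I_m -> R) (a b : rnode) : Prop :=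
  match a, b with
  | inl x, inr F | inr F, inl x =>
      tilde_vertices sigma x /\ is_face F /\ (closure F `\` F) x
  | _, _ => False
  end.

Definition radial_walk (sigma : 'I_m -> R) (u v : pt) (len : nat)
    (w : nat -> rnode) : Prop :=
  w 0%N = inl u /\ w len = inl v /\
  forall i, (i < len)%N -> radial_adj sigma (w i) (w i.+1).

Definition is_face_node (a : rnode) : bool :=
  if a is inr _ then true else false.

Definition num_face_nodes (len : nat) (w : nat -> rnode) : nat :=
  count (fun i => is_face_node (w i)) (iota 0 len.+1).

(* d_F(u,v) >= r in Lambda(tilde G): every shortest u-v path in the radial
   graph contains at least r face-vertices (vacuous if no path: d_F = oo) *)
Definition face_dist_ge (sigma : 'I_m -> R) (u v : pt) (r : nat) : Prop :=
  forall len w, radial_walk sigma u v len w ->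
    (forall len' w', radial_walk sigma u v len' w' -> (len <= len')%N) ->
    (r <= num_face_nodes len w)%N.

End Geometry.

(* Main.v *)
(* Take two square lattices, shifted by half a period against each other, replace
   each lattice edge by two complete graphs on [p + 2] vertices, one at each end
   and containing the lattice point, joined by [p + 1] parallel edges ("tracks"),
   and link the two resulting graphs A and B by [p] edges ("rungs") lying far
   apart from each other and from the border.  A and B are [p + 1]-edge-connected,
   so the rungs are the only cut of size at most [p].

   The vertices of each complete graph lie on a small arc of parabola whose
   outside contains the tracks.  Hence an edge of it is crossed only by edges of
   the same complete graph having an endpoint on each side, at most [p^2 / 4 <= k]
   of them; a horizontal track of one lattice is crossed only by the [p + 1 <= k]
   tracks of the one vertical lattice edge of the other lattice that it meets.

   One track of each lattice edge lies on the lattice line, so each face inside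
   the square covered by A is contained in a cell of A: traversing a face changes
   the coordinates by at most the side of a cell. *)

Require Import Defs.
From HB Require Import structures.
From mathcomp Require Import all_boot all_order all_algebra.
From mathcomp Require Import all_classical all_reals all_analysis.
From mathcomp Require Import ring lra zify.
Set Implicit Arguments. Unset Strict Implicit. Unset Printing Implicit Defensive.
Import Order.TTheory GRing.Theory Num.Theory.
Import numFieldNormedType.Exports.
Local Open Scope classical_set_scope.
Local Open Scope ring_scope.

(** * Chords of a parabola *)

(** In a plane graph the edges of a minimum cut form a cycle of the dual, so consecutive ones share
    a face. The two shores therefore have to overlap, and the difficulty is to overlay them with few
    crossings on every edge. The half-period shift puts each lattice point at the centre of a cell
    of the other lattice. Lattice edges of A and B then cross only at their midpoints, where no
    clique reaches, and a rung is half a diagonal of a cell and is crossed by nothing.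

    The definition of a drawing also forbids a third edge through a crossing. Tracks satisfy this
    because two edges that cross the same track are parallel; for the cliques the points of the
    parabola are chosen in general position.

    Every edge is a segment, so transversality and uniqueness of intersection points both reduce to
    a nonzero cross product of directions. The distance bound follows the coordinates along a walk;
    the rungs stay away from the border because the outer face is not contained in a cell. *)

Section Concurrency.
Variable R : realFieldType.

(* The chord of the parabola [y = x^2] through the points of abscissas [a] and [b]
   has equation [y = (a + b) x - a b]; [conc] is the determinant of the rows
   [(1, sum, product)] of the three chords [ab], [cd], [ef]. *)
Definition conc (a b c d e f : R) : R :=
  (c + d) * (e * f) - (e + f) * (c * d) - (a + b) * (e * f - c * d)
  + a * b * (e + f - (c + d)).

(** Adding [y] times the first column and [- x] times the second to the product column preserves the
    determinant. At a common point the new column vanishes; the identity expands along it. *)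
Lemma conc_eq0 a b c d e f x y :
  y = (a + b) * x - a * b -> y = (c + d) * x - c * d ->
  y = (e + f) * x - e * f -> conc a b c d e f = 0.
Proof.
move=> E1 E2 E3.
have -> : conc a b c d e f =
   (y - (a + b) * x + a * b) * (e + f - (c + d))
   - (y - (c + d) * x + c * d) * (e + f - (a + b))
   + (y - (e + f) * x + e * f) * (c + d - (a + b)) by rewrite /conc; ring.
by rewrite {1}E1 {1}E2 {1}E3; ring.
Qed.

Lemma conc_swap a b c d e f : conc b a c d e f = conc a b c d e f.
Proof. by rewrite /conc; ring. Qed.
Lemma conc_rot a b c d e f : conc c d e f a b = conc a b c d e f.
Proof. by rewrite /conc; ring. Qed.

(** The substitution comes from an affine map preserving the parabola, so it keeps concurrency. It
    allows the abscissas to be normalised after they have been chosen generically. *)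
Lemma conc_affine z h a b c d e f :
  conc (z * (a - h)) (z * (b - h)) (z * (c - h)) (z * (d - h)) (z * (e - h))
    (z * (f - h)) = z ^+ 3 * conc a b c d e f.
Proof. by rewrite /conc; ring. Qed.

(* [conc] is affine in its last variable, and [conc_shared] shows that it is not
   identically zero: each new abscissa has finitely many forbidden values. *)
Lemma conc_last a b c d e f :
  conc a b c d e f =
  conc a b c d e 0 + f * (conc a b c d e 1 - conc a b c d e 0).
Proof. by rewrite /conc; ring. Qed.

Lemma conc_shared a b c d e :
  conc a b c d e a = (a - c) * (a - d) * (b - e).
Proof. rewrite /conc; ring. Qed.

Lemma finite_upper_bound (I : finType) (f : I -> R) : exists M, forall i, f i < M.
Proof.
exists (1 + \sum_i `|f i|) => i.
rewrite (bigD1 i) //=; have := ler_norm (f i).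
have : 0 <= \sum_(j | j != i) `|f j| by apply: sumr_ge0.
lra.
Qed.

(** Chords with a common end meet only there, so three pairwise crossing chords have six distinct
    ends. *)
Definition no_concurrent (n : nat) (a : nat -> R) :=
  forall i1 i2 i3 i4 i5 i6 : nat, uniq [:: i1; i2; i3; i4; i5; i6] ->
  all (fun i => i <= n)%N [:: i1; i2; i3; i4; i5; i6] ->
  conc (a i1) (a i2) (a i3) (a i4) (a i5) (a i6) != 0.

Lemma leq_neqS i n : (i <= n.+1)%N -> i != n.+1 -> (i <= n)%N.
Proof. by rewrite leq_eqVlt => /orP[->|]. Qed.

Ltac split_ands :=
  repeat match goal with H : is_true (_ && _) |- _ =>
    let H1 := fresh in let H2 := fresh in case/andP: H => [H1 H2] end.
Ltac distinct_indices :=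
  rewrite /= ?inE ?negb_or; repeat (apply/andP; split);
  by [ | assumption | rewrite eq_sym; assumption
     | apply: leq_neqS => //; rewrite eq_sym; assumption].

Lemma exists_no_concurrent (n : nat) : exists a : nat -> R,
  (forall i j, (i < j <= n)%N -> a i < a j) /\ no_concurrent n a.
Proof.
elim: n => [|n [a [amono agen]]].
  exists (fun _ => 0); split; first by move=> i j; lia.
  by move=> [|?] [|?] i3 i4 i5 i6 //= _ /andP[].
have [M1 M1P] := @finite_upper_bound 'I_n.+1 (fun i => a i).
(* For five old abscissas the affine function [D] has at most one root, the quotient below. The new
   abscissa is taken above all these roots and all old abscissas. *)
have [M2 M2P] := @finite_upper_bound
  ('I_n.+1 * 'I_n.+1 * 'I_n.+1 * 'I_n.+1 * 'I_n.+1)%type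
  (fun t => let: (i1, i2, i3, i4, i5) := t in
    let D := conc (a i1) (a i2) (a i3) (a i4) (a i5) in - D 0 / (D 1 - D 0)).
pose M := Num.max M1 M2.
pose a' i := if (i <= n)%N then a i else M.
have MP i : (i <= n)%N -> a i < M.
  by move=> li; rewrite /M lt_max (M1P (Ordinal (li : (i < n.+1)%N))).
have key i1 i2 i3 i4 i5 : uniq [:: i1; i2; i3; i4; i5] ->
  all (fun i => i <= n)%N [:: i1; i2; i3; i4; i5] ->
  conc (a i1) (a i2) (a i3) (a i4) (a i5) M != 0.
  move=> U A; rewrite conc_last.
  set D := conc (a i1) _ _ _ _; apply/negP => /eqP D0.
  have [C0|C0] := eqVneq (D 1 - D 0) 0.
    have : D (a i1) = 0 by rewrite /D conc_last -/D; move: D0; rewrite C0 !mulr0.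
    rewrite /D conc_shared => /eqP; rewrite !mulf_eq0 !subr_eq0.
    have inj i j : (i <= n)%N -> (j <= n)%N -> (a i == a j) = (i == j).
      move=> li lj; case: (ltngtP i j) => [ij|ij|->]; last by rewrite eqxx.
        by apply/lt_eqF/amono; rewrite ij.
      by apply/gt_eqF/amono; rewrite ij.
    by move: U A; rewrite /= !inE => U A; rewrite !inj; lia.
  move: A => /= /and5P[l1 l2 l3 l4 /andP[l5 _]].
  have := M2P (Ordinal (l1 : (i1 < n.+1)%N), Ordinal (l2 : (i2 < n.+1)%N),
    Ordinal (l3 : (i3 < n.+1)%N), Ordinal (l4 : (i4 < n.+1)%N),
    Ordinal (l5 : (i5 < n.+1)%N)) => /=.
  rewrite -/D => H; have : M2 <= M by rewrite /M le_max lexx orbT.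
  suff : M = - D 0 / (D 1 - D 0) by move: H; lra.
  by apply/(mulIf C0); rewrite divfK //; lra.
have a'E i : (i <= n)%N -> a' i = a i by rewrite /a' => ->.
have a'M : a' n.+1 = M by rewrite /a' ltnn.
exists a'; split.
  move=> i j lij; have [lj|lj] := leqP j n.
    by rewrite !a'E ?amono; lia.
  have -> : j = n.+1 by lia.
  by rewrite a'M a'E ?MP; lia.
move=> i1 i2 i3 i4 i5 i6; rewrite /= !inE !negb_or => U A; split_ands.
(* At most one of the six indices is the new one; the symmetries of [conc] move it to the last
   place. *)
have [E6|N6] := eqVneq i6 n.+1.
  by subst i6; rewrite a'M !a'E; [apply: key|..]; distinct_indices.
have [E5|N5] := eqVneq i5 n.+1.
  by rewrite -conc_rot -conc_rot -conc_swap -conc_rot; subst i5; rewrite a'M !a'E;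
    [apply: key|..]; distinct_indices.
have [E4|N4] := eqVneq i4 n.+1.
  by rewrite -conc_rot -conc_rot; subst i4; rewrite a'M !a'E; [apply: key|..];
    distinct_indices.
have [E3|N3] := eqVneq i3 n.+1.
  by rewrite -conc_rot -conc_swap -conc_rot; subst i3; rewrite a'M !a'E;
    [apply: key|..]; distinct_indices.
have [E2|N2] := eqVneq i2 n.+1.
  by rewrite -conc_rot; subst i2; rewrite a'M !a'E; [apply: key|..]; distinct_indices.
have [E1|N1] := eqVneq i1 n.+1.
  by rewrite -conc_swap -conc_rot; subst i1; rewrite a'M !a'E; [apply: key|..];
    distinct_indices.
by rewrite !a'E; [apply: agen|..]; distinct_indices.
Qed.

(** The bound 1/4 keeps the chords in the cone [0 <= y <= x / 4] and within 1/4 of their node, which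
    separates the four cliques of a node from each other and from those of other nodes. *)
Lemma exists_generic_heights (n : nat) : exists a : nat -> R,
  [/\ a 0%N = 0, forall i j, (i < j <= n)%N -> a i < a j,
      forall i, (i <= n)%N -> a i <= 4^-1 & no_concurrent n a].
Proof.
have [b [bmono bgen]] := exists_no_concurrent n.
pose z : R := (4 * (b n - b 0%N + 1))^-1.
have bn : b 0%N <= b n.
  by case: n {z bgen} bmono => [|n] bm //; apply/ltW/bm; lia.
have z0 : 0 < z by rewrite invr_gt0; lra.
exists (fun i => z * (b i - b 0%N)); split.
- by rewrite subrr mulr0.
- by move=> i j lij; rewrite ltr_pM2l // ltrD2r; exact: bmono.
- move=> i li; have : b i <= b n.
    by case: (ltngtP i n) li => // [lin|->//] _; apply/ltW/bmono; lia.
  move=> lb; rewrite /z mulrC ler_pdivrMr; lra.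
- move=> i1 i2 i3 i4 i5 i6 U A; rewrite conc_affine mulf_neq0 ?bgen //.
  by rewrite expf_neq0 ?gt_eqF.
Qed.

End Concurrency.

(** * Straight-line drawings *)

Section Segments.
Variable R : realType.
Implicit Types P Q : pt R.

Definition lerp P Q (t : R) : pt R :=
  (P.1 + t * (Q.1 - P.1), P.2 + t * (Q.2 - P.2)).

Definition cross_prod P Q P' Q' : R :=
  (Q.1 - P.1) * (Q'.2 - P'.2) - (Q.2 - P.2) * (Q'.1 - P'.1).

Lemma lerp0 P Q : lerp P Q 0 = P.
Proof. by rewrite /lerp !mul0r !addr0; case: P. Qed.

Lemma lerp1 P Q : lerp P Q 1 = Q.
Proof. by rewrite /lerp !mul1r ![_ + (_ - _)]addrC !subrK; case: Q. Qed.

Lemma lerp_inj P Q : P <> Q -> injective (lerp P Q).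
Proof.
move=> PQ s t [E1 E2]; apply/eqP; rewrite -subr_eq0; apply/eqP.
have F1 : (s - t) * (Q.1 - P.1) = 0 by move: E1; nra.
have F2 : (s - t) * (Q.2 - P.2) = 0 by move: E2; nra.
have [//|st] := eqVneq (s - t) 0; case: PQ.
move/eqP: F1; rewrite mulf_eq0 (negbTE st) subr_eq0 /= => /eqP F1.
move/eqP: F2; rewrite mulf_eq0 (negbTE st) subr_eq0 /= => /eqP F2.
by clear E1 E2; case: P Q F1 F2 => [p1 p2] [q1 q2] /= -> ->.
Qed.

Lemma pair_continuous (T : topologicalType) (f g : T -> R) :
  continuous f -> continuous g -> continuous (fun x => (f x, g x) : pt R).
Proof.
move=> cf cg x.
exact: (@cvg_pair _ _ _ (nbhs x) (nbhs (f x)) (nbhs (g x)) _ _ _ _ _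
  (cf x) (cg x)).
Qed.

Lemma affine_continuous (c0 c1 c2 : R) :
  continuous (fun y : pt R => c0 + c1 * y.1 + c2 * y.2).
Proof.
move=> y; apply: cvgD; [apply: cvgD|]; first exact: cvg_cst.
  by apply: cvgM; [exact: cvg_cst|exact: cvg_fst].
by apply: cvgM; [exact: cvg_cst|exact: cvg_snd].
Qed.

Lemma affine_pair_continuous (a0 a1 a2 b0 b1 b2 : R) :
  continuous (fun y : pt R =>
    (a0 + a1 * y.1 + a2 * y.2, b0 + b1 * y.1 + b2 * y.2) : pt R).
Proof.
by apply: pair_continuous; exact: affine_continuous.
Qed.

Lemma lerp_continuous P Q : continuous (lerp P Q).
Proof.
apply: pair_continuous => t; apply: cvgD; try exact: cvg_cst;
  by apply: cvgM; [exact: cvg_id|exact: cvg_cst].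
Qed.

Lemma open_openSq : open (@openSq R).
Proof.
have -> : @openSq R = [set z : pt R | `|z.1| < 1] `&` [set z | `|z.2| < 1] by [].
apply: openI.
  have -> : [set z : pt R | `|z.1| < 1] = (fun z : pt R =>
    `|z.1|) @^-1` [set x | x < 1] by [].
  apply: open_comp; last exact: open_lt.
  by move=> z _; apply: cvg_norm; exact: cvg_fst.
have -> : [set z : pt R | `|z.2| < 1] = (fun z : pt R =>
  `|z.2|) @^-1` [set x | x < 1] by [].
apply: open_comp; last exact: open_lt.
by move=> z _; apply: cvg_norm; exact: cvg_snd.
Qed.

(** The chart [phi] takes coordinates at the crossing in the basis of the two directions scaled by
    [h]; its formula is Cramer's rule. The factor [h] is small enough that the parallelogram
    contains no end of either segment in its interior, so each segment fills a whole axis of the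
    square. *)
Lemma transversal_segments m (curve : 'I_m -> R -> pt R) e f P Q P' Q' s s' :
  curve e = lerp P Q -> curve f = lerp P' Q' ->
  cross_prod P Q P' Q' != 0 ->
  0 < s < 1 -> 0 < s' < 1 -> lerp P Q s = lerp P' Q' s' ->
  transversal_at curve e f (lerp P Q s).
Proof.
move=> Ee Ef D0 /andP[s0 s1] /andP[s'0 s'1] Ess'.
set x := lerp P Q s; set D := cross_prod _ _ _ _ in D0.
pose h := Num.min (Num.min s (1 - s)) (Num.min s' (1 - s')).
have h0 : 0 < h by rewrite !lt_min s0 s'0 !subr_gt0 s1.
have hs : h <= s by rewrite /h !ge_min lexx.
have hs1 : h <= 1 - s by rewrite /h !ge_min lexx ?orbT.
have hs' : h <= s' by rewrite /h !ge_min lexx ?orbT.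
have hs1' : h <= 1 - s' by rewrite /h !ge_min lexx ?orbT.
pose d1 := Q.1 - P.1; pose d2 := Q.2 - P.2.
pose d1' := Q'.1 - P'.1; pose d2' := Q'.2 - P'.2.
have DE : D = d1 * d2' - d2 * d1' by [].
have hD : h * D != 0 by rewrite mulf_neq0 // gt_eqF.
pose phi (y : pt R) : pt R :=
  ((x.2 * d1' - x.1 * d2') / (h * D) + d2' / (h * D) * y.1 + - d1' / (h * D) * y.2,
   (x.1 * d2 - x.2 * d1) / (h * D) + - d2 / (h * D) * y.1 + d1 / (h * D) * y.2).
pose psi (z : pt R) : pt R :=
  (x.1 + h * d1 * z.1 + h * d1' * z.2, x.2 + h * d2 * z.1 + h * d2' * z.2).
have cphi : continuous phi by apply: affine_pair_continuous.
have cpsi : continuous psi by apply: affine_pair_continuous.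
have hn : h != 0 by rewrite gt_eqF.
have phiK y : psi (phi y) = y.
  by case: y => y1 y2; rewrite /psi /phi /=; congr pair; rewrite DE; field;
    rewrite hn -DE D0.
have psiK z : phi (psi z) = z.
  by case: z => z1 z2; rewrite /psi /phi /=; congr pair; rewrite DE; field;
    rewrite hn -DE D0.
have phix : phi x = (0, 0).
  by rewrite /phi; congr pair; rewrite DE; field; rewrite hn -DE D0.
have phil t : phi (lerp P Q t) = ((t - s) / h, 0).
  rewrite -[RHS]psiK; congr phi; rewrite /psi /lerp /x /lerp /= -/d1 -/d2.
  by congr pair; field.
have phil' t : phi (lerp P' Q' t) = (0, (t - s') / h).
  rewrite -[RHS]psiK; congr phi; rewrite /psi /x Ess' /lerp /= -/d1' -/d2'.
  by congr pair; field.
exists (phi @^-1` @openSq R), phi, psi.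
split.
  by apply: open_comp; [move=> y _; exact: cphi|exact: open_openSq].
split.
  by rewrite /preimage /= phix /openSq /= normr0 ltr01.
split.
  exact: continuous_subspaceT.
split.
  exact: continuous_subspaceT.
split.
  by move=> _ [y Uy <-].
split.
  by move=> _ [z Sz <-]; rewrite /preimage /= psiK.
split.
  by [].
split.
  by [].
split.
  exact: phix.
split.
  rewrite eqEsubset; split => [_ [y [Uy [t It Et]] <-]|z [Sz /= z2]].
    have E : phi y = ((t - s) / h, 0) by rewrite -Et Ee phil.
have Sq : @openSq R (phi y) by exact: Uy.
by rewrite E in Sq *; exact: (conj Sq erefl).
  exists (psi z); last exact: psiK.
  split; first by rewrite /preimage /= psiK.
  exists (s + h * z.1).
    move: Sz => [+ _]; rewrite ltr_norml /I01 /= => /andP[l u].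
    have : 0 < h * (1 + z.1) /\ 0 < h * (1 - z.1) by split; apply: mulr_gt0 => //; lra.
    by case; rewrite mulrDr mulrBr mulr1 => u1 u2; apply/andP; split; lra.
  rewrite Ee; rewrite -[LHS]phiK phil; congr psi; case: z z2 {Sz} => z1 z2 /= ->.
  by congr pair; field.
rewrite eqEsubset; split => [_ [y [Uy [t It Et]] <-]|z [Sz /= z2]].
  have E : phi y = (0, (t - s') / h) by rewrite -Et Ef phil'.
have Sq : @openSq R (phi y) by exact: Uy.
by rewrite E in Sq *; exact: (conj Sq erefl).
exists (psi z); last exact: psiK.
split; first by rewrite /preimage /= psiK.
exists (s' + h * z.2).
  move: Sz => [_ +]; rewrite ltr_norml /I01 /= => /andP[l u].
  have : 0 < h * (1 + z.2) /\ 0 < h * (1 - z.2) by split; apply: mulr_gt0 => //; lra.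
  by case; rewrite mulrDr mulrBr mulr1 => u1 u2; apply/andP; split; lra.
rewrite Ef; rewrite -[LHS]phiK phil'; congr psi; case: z z2 {Sz} => z1 z2' /= ->.
by congr pair; field.
Qed.

Lemma lerp_meet_unique P Q P' Q' s t s' t' : cross_prod P Q P' Q' != 0 ->
  lerp P Q s = lerp P' Q' s' -> lerp P Q t = lerp P' Q' t' ->
  lerp P Q s = lerp P Q t.
Proof.
rewrite /cross_prod /lerp => D0 [E1 E2] [F1 F2].
suff -> : s = t by [].
apply: (mulIf D0); apply/eqP; rewrite -subr_eq0; apply/eqP.
have G1 : (s - t) * (Q.1 - P.1) = (s' - t') * (Q'.1 - P'.1) by nra.
have G2 : (s - t) * (Q.2 - P.2) = (s' - t') * (Q'.2 - P'.2) by nra.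
rewrite -mulrBl mulrBr !mulrA G1 G2; ring.
Qed.

(** * A combinatorial criterion for a straight-line drawing to be k-plane *)

Section StraightLineDrawing.
Variables (n m k : nat) (src tgt : 'I_m -> 'I_n) (pos : 'I_n -> pt R).
(** A combinatorial relation that contains all geometric crossings, so that they can be bounded by
    counting edges instead of points. *)
Variable crosses : 'I_m -> 'I_m -> Prop.

Definition straight e := lerp (pos (src e)) (pos (tgt e)).

Hypothesis pos_inj : injective pos.
Hypothesis simple : simple_graph src tgt.
Hypothesis incident : forall v, exists e, v = src e \/ v = tgt e.
Hypothesis meet : forall e f x, e <> f -> img straight e x -> img straight f x ->
  (exists v, [/\ x = pos v, v = src e \/ v = tgt e & v = src f \/ v = tgt f])
  \/ [/\ crosses e f, img_int straight e x & img_int straight f x].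
Hypothesis crosses_transversal : forall e f, crosses e f ->
  cross_prod (pos (src e)) (pos (tgt e)) (pos (src f)) (pos (tgt f)) != 0.
Hypothesis no_triple : forall e f g x, e <> f -> e <> g -> f <> g ->
  img straight e x -> img straight f x -> img straight g x ->
  crosses e f -> crosses e g -> crosses f g -> False.
Hypothesis few_crossings : forall e,
  (#|[set f : 'I_m | `[< crosses e f >]]%SET| <= k)%N.

Let ends_neq e : pos (src e) <> pos (tgt e).
Proof. by move=> /pos_inj E; have := simple.1 e; rewrite E eqxx. Qed.

Let int_img e x : img_int straight e x -> img straight e x.
Proof.
move=> [t /andP[t0 t1] <-]; exists t => //; by rewrite /I01 /= !ltW.
Qed.

Let end_img e v : v = src e \/ v = tgt e -> img straight e (pos v).
Proof.
move=> [->|->]; [exists 0|exists 1].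
- by rewrite /I01 /= lexx ler01.
- exact: lerp0.
- by rewrite /I01 /= lexx ler01.
- exact: lerp1.
Qed.

Let end_not_int e v : v = src e \/ v = tgt e -> ~ img_int straight e (pos v).
Proof.
move=> ve [t /andP[t0 t1]]; move: ve => [->|->].
  by rewrite -[RHS](lerp0 _ (pos (tgt e))) => /(lerp_inj (@ends_neq e)) /eqP; lra.
by rewrite -[RHS](lerp1 (pos (src e))) => /(lerp_inj (@ends_neq e)) /eqP; lra.
Qed.

(** Every vertex is an end of some edge, so a vertex inside an edge would be a common point of two
    edges, to which [meet] applies. *)
Let vertex_not_int e v : ~ img_int straight e (pos v).
Proof.
move=> ev; have [f vf] := incident v.
have [E|N] := pselect (e = f); first by rewrite E in ev; exact: end_not_int ev.
case: (meet N (int_img ev) (end_img vf)) => [[w [/pos_inj E we _]]|[_ _ fv]].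
  by rewrite E in ev; exact: end_not_int ev.
exact: end_not_int fv.
Qed.

Let crosses_int e f x : e <> f -> img_int straight e x -> img straight f x ->
  crosses e f.
Proof.
move=> ef ex fx; have [[v [xv ve _]]|[]//] := meet ef (int_img ex) fx.
by rewrite xv in ex; case: (end_not_int ve ex).
Qed.

Lemma straight_drawing : is_drawing src tgt pos straight.
Proof.
split; first exact: pos_inj.
split; first by move=> e; apply: continuous_subspaceT; exact: lerp_continuous.
split; first by move=> e s t _ _; exact: lerp_inj (@ends_neq e) _ _.
split; first by move=> e; rewrite /straight lerp0 lerp1.
split; first exact: vertex_not_int.
move=> e f x ef ex fx; split.
  move=> g ge gf gx; have eg : e <> g by apply/nesym.
  have fg : f <> g by apply/nesym.
  apply: (no_triple ef eg fg (int_img ex) (int_img fx) gx).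
  - exact: crosses_int ef ex (int_img fx).
  - exact: crosses_int eg ex gx.
  - exact: crosses_int fg fx gx.
have cef := crosses_int ef ex (int_img fx).
move: ex fx => [s s01 <-] [s' s'01 E].
by apply: (@transversal_segments _ _ e f (pos (src e)) (pos (tgt e))
  (pos (src f)) (pos (tgt f)) s s') => //; exact: crosses_transversal.
Qed.

Lemma straight_k_plane : is_k_plane src tgt pos straight k.
Proof.
split; first exact: straight_drawing.
split.
  move=> e.
  pose A := [set f : 'I_m | `[< crosses e f >]]%SET.
  (* Two crossing edges have a single common point, so one chosen point for each [f] covers all
     crossings on [e]; the default matters only for an [f] that does not meet the interior of
     [e]. *)
  pose pick f := xget (0, 0) [set x | img_int straight e x /\ img_int straight f x].
  exists [seq pick f | f <- enum A]; split.
    by rewrite size_map -cardE; exact: few_crossings.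
  move=> x ex [f1 [f2 [f12 [f1x f2x]]]].
  have [f [ef fx]] : exists f, e <> f /\ img_int straight f x.
    have [E|N] := pselect (e = f1); last by exists f1.
    by exists f2; split=> //; rewrite E.
  have cef := crosses_int ef ex (int_img fx).
  apply/mapP; exists f; first by rewrite mem_enum inE; apply/asboolP.
  have [] : [set y | img_int straight e y /\ img_int straight f y] (pick f).
    by apply: (xgetPex (0,0)); exists x.
  move: ex fx => [s _ <-] [s' _ E] [t _ <-] [t' _ F].
  apply: lerp_meet_unique (crosses_transversal cef) (esym E) (esym F).
move=> e f ef x y ex fx ey fy.
have crossE : crosses e f -> x = y.
  move=> cef; move: ex fx ey fy => [s _ <-] [s' _ E] [t _ <-] [t' _ F].
  exact: lerp_meet_unique (crosses_transversal cef) (esym E) (esym F).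
case: (meet ef ex fx) => [[v [xv ve vf]]|[cef _ _]]; last exact: crossE.
case: (meet ef ey fy) => [[w [yw we wf]]|[cef _ _]]; last exact: crossE.
rewrite xv yw; congr pos; have [//|/eqP vw] := eqVneq v w.
case: ef; apply: simple.2.
case: ve vf we wf vw => [->|->] [E|E] [->|->] [F|F] vw;
  by move: vw; rewrite ?E ?F ?eqxx ?orbT -?E -?F ?eqxx ?orbT.
Qed.

End StraightLineDrawing.
End Segments.

(** * The graph and its minimum cut *)

(** A cut of size at most that of [T] must contain [T], hence equals it: minimality and uniqueness
    come together. *)
Lemma unique_min_edge_cut_card n m (src tgt : 'I_m -> 'I_n) (T : {set 'I_m}) :
  is_edge_cut src tgt T ->
  (forall T' : {set 'I_m}, (#|T'| <= #|T|)%N -> ~~ (T \subset T') ->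
     forall u v, connect (adj_without src tgt T') u v) ->
  unique_min_edge_cut src tgt T.
Proof.
move=> Tcut conn.
have sub T' : is_edge_cut src tgt T' -> (#|T'| <= #|T|)%N -> T \subset T'.
  by move=> [u [v uv]] le; apply: contraNT uv => NT; exact: conn.
split; first split=> // T' T'cut.
  by rewrite leqNgt; apply/negP => lt; have := subset_leq_card (sub _ T'cut (ltnW lt)); lia.
move=> T' [T'cut /(_ T Tcut) le]; apply/esym/eqP.
by rewrite eqEcard sub.
Qed.

Section Graph.
Variables (p K Y : nat) (X : nat -> nat).

(* The node [(b, i, j)] will be drawn at the point [(2 i + b, 2 j + b)]; the nodes
   with [b = false] lie on one shore of the cut, those with [b = true] on the
   other one. *)
Definition node : Type := (bool * 'I_K * 'I_K)%type.
(* [(swap, neg)]: right, left, up and down are [(false, false)], [(false, true)],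
   [(true, false)] and [(true, true)]. *)
Definition dir : Type := (bool * bool)%type.
Definition vertex : Type := (node * option (dir * 'I_p.+1))%type.
HB.instance Definition _ := Finite.on node.
HB.instance Definition _ := Finite.on dir.
HB.instance Definition _ := Finite.on vertex.
Implicit Types (w : node) (d : dir) (u v : vertex).

Definition side w : bool := w.1.1.
Definition nx w : nat := w.1.2.
Definition ny w : nat := w.2.

(* The [i]-th vertex, [i <= p + 1], of the clique leaving [w] in direction [d]; the
   four cliques at [w] share the vertex of index [0], the node itself. *)
Definition pv w d (i : nat) : vertex :=
  (w, if i is i'.+1 then Some (d, inord i') else None).

Definition nbr (o : bool) w w' : bool :=
  (side w == side w') &&
  if o then (nx w' == nx w) && (ny w' == (ny w).+1)
  else (nx w' == (nx w).+1) && (ny w' == ny w).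

Definition rung (t : nat) w w' : bool :=
  [&& ~~ side w, side w', nx w == X t, nx w' == X t, ny w == Y & ny w' == Y].

Inductive edge_spec : vertex -> vertex -> Prop :=
| CliqueEdge w d i j of (i < j <= p.+1)%N : edge_spec (pv w d i) (pv w d j)
| TrackEdge o w w' i of nbr o w w' & (i <= p)%N :
    edge_spec (pv w (o, false) i) (pv w' (o, true) i)
| RungEdge t w w' of (t < p)%N & rung t w w' : edge_spec (w, None) (w', None).

(** An edge is a pair of ends rather than a derivation of [edge_spec], which rules out multiple
    edges. *)
Definition edge : Type :=
  {e : (vertex * vertex)%type | `[< edge_spec e.1 e.2 >]}.
HB.instance Definition _ := Finite.on edge.

Definition nV := #|{: vertex}|.
Definition nE := #|{: edge}|.

Definition vof (v : 'I_nV) : vertex := enum_val v.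
Definition rk (v : vertex) : 'I_nV := enum_rank v.
Definition esrc (e : 'I_nE) : vertex := (val (enum_val e)).1.
Definition etgt (e : 'I_nE) : vertex := (val (enum_val e)).2.
Definition src (e : 'I_nE) : 'I_nV := rk (esrc e).
Definition tgt (e : 'I_nE) : 'I_nV := rk (etgt e).

Definition erk u v (uv : edge_spec u v) : 'I_nE :=
  enum_rank (exist (fun e : (vertex * vertex)%type => `[< edge_spec e.1 e.2 >])
    (u, v) (introT (asboolP _) uv) : edge).

Lemma rkK : cancel rk vof. Proof. exact: enum_rankK. Qed.
Lemma vofK : cancel vof rk. Proof. exact: enum_valK. Qed.
Lemma rk_inj : injective rk. Proof. exact: enum_rank_inj. Qed.

Lemma esrc_erk u v (uv : edge_spec u v) : esrc (erk uv) = u.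
Proof. by rewrite /esrc /erk enum_rankK. Qed.
Lemma etgt_erk u v (uv : edge_spec u v) : etgt (erk uv) = v.
Proof. by rewrite /etgt /erk enum_rankK. Qed.

Lemma edgeP e : edge_spec (esrc e) (etgt e).
Proof. by rewrite /esrc /etgt; case: (enum_val e) => /= uv /asboolP. Qed.

Lemma edge_inj e f : esrc e = esrc f -> etgt e = etgt f -> e = f.
Proof.
move=> es et; apply: enum_val_inj; apply: val_inj.
by rewrite [LHS]surjective_pairing [RHS]surjective_pairing; congr pair.
Qed.

Lemma pv_inj w d w' d' i j : (i <= p.+1)%N -> (j <= p.+1)%N ->
  pv w d i = pv w' d' j -> i = j.
Proof.
case: i j => [|i] [|j] //= li lj [] _ _ /(congr1 val).
by rewrite /= !inordK // => ->.
Qed.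

(* Every edge goes from a lower to a higher vertex, so no edge occurs with both
   orientations. *)
Definition height v : nat :=
  (if v.2 is Some (_, i) then i.+1 else 0%N) + nx v.1 + ny v.1 + side v.1.

Lemma height_pv w d i : (i <= p.+1)%N ->
  height (pv w d i) = (i + nx w + ny w + side w)%N.
Proof. by case: i => [//|i] li; rewrite /height /= inordK. Qed.

Lemma edge_height u v : edge_spec u v -> (height u < height v)%N.
Proof.
case=> [w d i j ij|o w w' i ww' ip|t w w' tp].
- by rewrite !height_pv; lia.
- rewrite !height_pv; try lia.
  by move: ww'; rewrite /nbr; case: o => /andP[/eqP-> ]; lia.
- rewrite /rung /height /=; case: (side w) => //; case: (side w') => //=.
  lia.
Qed.

Lemma simple_src_tgt : simple_graph src tgt.
Proof.
split=> [e|e f].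
  apply/eqP => /rk_inj E; have := edge_height (edgeP e).
  by rewrite E ltnn.
move=> /orP[] /andP[/eqP /rk_inj s /eqP /rk_inj t]; first exact: edge_inj.
have := edge_height (edgeP e); have := edge_height (edgeP f).
by rewrite s t; lia.
Qed.

Lemma vertexP v : (exists w, v = (w, None)) \/
  exists w d i, (i <= p)%N /\ v = pv w d i.+1.
Proof.
case: v => w [[d i]|]; last by left; exists w.
right; exists w, d, i; split; first by rewrite -ltnS.
by rewrite /pv inord_val.
Qed.

Lemma incident_edge (v : 'I_nV) : exists e, v = src e \/ v = tgt e.
Proof.
have [[w E]|[w [d [i [ip E]]]]] := vertexP (vof v).
  have h : edge_spec (pv w (false, false) 0) (pv w (false, false) 1).
    exact: CliqueEdge.
  exists (erk h); left; apply: (can_inj vofK).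
  by rewrite /src rkK esrc_erk E.
have h : edge_spec (pv w d 0) (pv w d i.+1) by exact: CliqueEdge.
exists (erk h); right; apply: (can_inj vofK).
by rewrite /tgt rkK etgt_erk E.
Qed.

Definition joins (e : 'I_nE) u v : Prop :=
  (esrc e = u /\ etgt e = v) \/ (esrc e = v /\ etgt e = u).

Lemma joins_erk u v (uv : edge_spec u v) : joins (erk uv) u v.
Proof. by left; rewrite esrc_erk etgt_erk. Qed.

Lemma clique_joins w d i j : (i <= p.+1)%N -> (j <= p.+1)%N -> i <> j ->
  exists e, joins e (pv w d i) (pv w d j).
Proof.
move=> li lj ij; have [lt|le] := ltnP i j.
  have h : edge_spec (pv w d i) (pv w d j) by apply: CliqueEdge; lia.
  by exists (erk h); exact: joins_erk.
have h : edge_spec (pv w d j) (pv w d i) by apply: CliqueEdge; lia.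
by exists (erk h); have [] := joins_erk h; [right|left].
Qed.

(** * Connectivity of each shore after the removal of at most p edges *)

Section Removal.
Variable T' : {set 'I_nE}.

Definition linked u v := connect (adj_without src tgt T') (rk u) (rk v).

Lemma linked_sym u v : linked u v -> linked v u.
Proof.
rewrite /linked sym_connect_sym // => x y.
by apply: eq_existsb => e; rewrite orbC.
Qed.

Lemma linked_trans u v v' : linked u v -> linked v v' -> linked u v'.
Proof. exact: connect_trans. Qed.

Lemma linked_refl u : linked u u.
Proof. exact: connect0. Qed.

Lemma joins_linked e u v : e \notin T' -> joins e u v -> linked u v.
Proof.
move=> eT uv; apply: connect1; apply/existsP; exists e; rewrite eT /=.
by rewrite /src /tgt; case: uv => [[-> ->]|[-> ->]]; rewrite !eqxx ?orbT.
Qed.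

Hypothesis T'p : (#|T'| <= p)%N.

Lemma no_p_injection (f : 'I_p.+1 -> 'I_nE) :
  injective f -> ~ (forall i, f i \in T').
Proof.
move=> finj fT; have : (#|[set f i | i : 'I_p.+1]%SET| <= #|T'|)%N.
  by apply: subset_leq_card; apply/fintype.subsetP => _ /imsetP[i _ ->].
by rewrite card_imset // card_ord; lia.
Qed.

(* If [i] and [j] were separated, the edge [ij] and, for each third index [z],
   one of the edges [iz], [zj] would be removed: [p + 1] distinct edges. *)
Lemma clique_linked w d i j : (i <= p.+1)%N -> (j <= p.+1)%N ->
  linked (pv w d i) (pv w d j).
Proof.
move=> li lj; apply: contrapT => N.
have ij : i <> j by move=> E; apply: N; rewrite E; exact: linked_refl.
have inT e u v : joins e u v -> ~ linked u v -> e \in T'.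
  by move=> J NL; apply: contrapT => /negP eT; apply: NL; exact: joins_linked J.
(* [bump i] enumerates the [p.+1] indices other than [i]; the value [j] accounts for the edge [ij]
   itself. *)
have ex (z : 'I_p.+1) : exists e, e \in T' /\
  (joins e (pv w d i) (pv w d (bump i z)) \/
   (bump i z <> j /\ joins e (pv w d (bump i z)) (pv w d j))).
  have lz : (bump i z <= p.+1)%N by rewrite /bump; have := ltn_ord z; lia.
  have zi : i <> bump i z by rewrite /bump; lia.
  have [e1 J1] := clique_joins w d li lz zi.
  have [L|NL] := pselect (linked (pv w d i) (pv w d (bump i z))); last first.
    by exists e1; split; [exact: inT NL|left].
  have zj : bump i z <> j by move=> E; apply: N; rewrite -E.
  have [e2 J2] := clique_joins w d lz lj zj.
  exists e2; split; last by right.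
  by apply: inT J2 _ => L2; apply: N; exact: linked_trans L2.
have [f fP] := choice ex.
apply: (@no_p_injection f); last by move=> z; have [] := fP z.
move=> z z' E; apply: ord_inj; apply: (can_inj (bumpK i)).
have lz (y : 'I_p.+1) : (bump i y <= p.+1)%N by rewrite /bump; have := ltn_ord y; lia.
have zi (y : 'I_p.+1) : i <> bump i y by rewrite /bump; lia.
have pvE i1 i2 : (i1 <= p.+1)%N -> (i2 <= p.+1)%N ->
  pv w d i1 = pv w d i2 -> i1 = i2 by exact: pv_inj.
have [_ h] := fP z; have [_ h'] := fP z'; rewrite -E in h'.
have := lz z; have := lz z'; have := zi z; have := zi z'.
move: (bump i z) (bump i z') h h' => y y' h h' iy' iy ly' ly.
case: h => [|[yj]] [] [E1 E2]; case: h' => [|[y'j]];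
  rewrite /joins E1 E2 => -[] [/pvE F1 /pvE F2];
  move: (F1 ltac:(lia) ltac:(lia)) (F2 ltac:(lia) ltac:(lia)); lia.
Qed.

(** One of the [p.+1] parallel tracks survives, and the cliques at its two ends link it to the
    nodes. *)
Lemma track_linked o w w' : nbr o w w' -> linked (w, None) (w', None).
Proof.
move=> ww'.
have h (i : 'I_p.+1) : edge_spec (pv w (o, false) i) (pv w' (o, true) i).
  by apply: TrackEdge; rewrite // -ltnS.
have [[i iT]|N] := pselect (exists i, erk (h i) \notin T').
  have li : (i <= p.+1)%N by apply/ltnW.
  apply: (@linked_trans _ (pv w (o, false) i)).
    exact: (@clique_linked w (o, false) 0 i).
  apply: (@linked_trans _ (pv w' (o, true) i)).
    exact: joins_linked iT (joins_erk _).
  exact: (@clique_linked w' (o, true) i 0).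
case: (@no_p_injection (fun i => erk (h i))); last first.
  by move=> i; apply: contrapT => /negP iT; apply: N; exists i.
move=> i j /(congr1 esrc); rewrite !esrc_erk => /pv_inj E.
by apply/ord_inj/E; apply: ltnW.
Qed.

Lemma node_eq w w' : side w = side w' -> nx w = nx w' -> ny w = ny w' -> w = w'.
Proof.
by case: w w' => [[b i] j] [[b' i'] j']; rewrite /side /nx /ny /=
  => -> /ord_inj -> /ord_inj ->.
Qed.

Lemma side_linked w w' : side w = side w' -> linked (w, None) (w', None).
Proof.
have K0 : (0 < K)%N by have := ltn_ord w.2; lia.
pose o0 := Ordinal K0.
suff root n (v : node) : (nx v + ny v <= n)%N -> linked (v, None) ((side v, o0, o0), None).
  move=> E; apply: linked_trans (root _ _ (leqnn _)) _; rewrite E.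
  exact: linked_sym (root _ _ (leqnn _)).
elim: n v => [|n IH] v le.
  suff <- : v = (side v, o0, o0) by exact: linked_refl.
  by apply: node_eq => //; rewrite /nx /ny /=; move: le; rewrite /nx /ny; lia.
have [x0|x0] := posnP (nx v); last first.
  have lt : ((nx v).-1 < K)%N by have := ltn_ord v.1.2; rewrite /nx; lia.
  pose v' : node := (side v, Ordinal lt, v.2).
  apply: (@linked_trans _ (v', None)); last first.
    by apply: (IH v'); move: le; rewrite /v' /nx /ny /=; move: x0; rewrite /nx; lia.
  apply: linked_sym; apply: (@track_linked false).
  rewrite /nbr /v' /side /ny /= !eqxx /=; move: x0; rewrite /nx /=; lia.
have [y0|y0] := posnP (ny v); first by apply: IH; lia.
have lt : ((ny v).-1 < K)%N by have := ltn_ord v.2; rewrite /ny; lia.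
pose v' : node := (side v, v.1.2, Ordinal lt).
apply: (@linked_trans _ (v', None)); last first.
  by apply: (IH v'); move: le; rewrite /v' /nx /ny /=; move: y0; rewrite /ny; lia.
apply: linked_sym; apply: (@track_linked true).
rewrite /nbr /v' /side /nx /= !eqxx /=; move: y0; rewrite /ny /=; lia.
Qed.

Lemma vertex_linked v : linked v (v.1, None).
Proof.
have [[w ->]|[w [d [i [ip ->]]]]] := vertexP v; first exact: linked_refl.
exact: (@clique_linked w d i.+1 0).
Qed.

End Removal.

(** * The rungs as the unique minimum cut *)

Hypothesis p0 : (0 < p)%N.
Hypothesis XK : forall t, (t < p)%N -> (X t < K)%N.
Hypothesis YK : (Y < K)%N.
Hypothesis X_inj : forall s t, (s < p)%N -> (t < p)%N -> X s = X t -> s = t.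

Definition rung_node (b : bool) (t : 'I_p) : node :=
  (b, Ordinal (XK (ltn_ord t)), Ordinal YK).

Lemma rung_spec t : edge_spec (rung_node false t, None) (rung_node true t, None).
Proof. by apply: (@RungEdge t); rewrite // /rung /= !eqxx. Qed.

Definition rung_edge (t : 'I_p) : 'I_nE := erk (rung_spec t).
Definition rungs : {set 'I_nE} := [set rung_edge t | t : 'I_p]%SET.

Lemma card_rungs : #|rungs| = p.
Proof.
rewrite card_imset ?card_ord // => s t /(congr1 esrc).
rewrite !esrc_erk => -[E]; apply/ord_inj/X_inj => //.
Qed.

Lemma rungs_cut : is_edge_cut src tgt rungs.
Proof.
pose t0 := Ordinal p0.
exists (rk (rung_node false t0, None)), (rk (rung_node true t0, None)).
pose A := [pred u | side (vof u).1].
have cl : fingraph.closed (adj_without src tgt rungs) A.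
  move=> u v /existsP[e /andP[eT uv]].
  have E : side (esrc e).1 = side (etgt e).1.
    move: eT; have [E1 E2] : esrc e = esrc e /\ etgt e = etgt e by [].
    case: {-1}_ {-1}_ / (edgeP e) E1 E2 => [//|o w w' i|t w w' tp].
      by rewrite /nbr => /andP[/eqP].
    rewrite /rung => /and5P[w0 w1 /eqP wx /eqP wx' /andP[/eqP wy /eqP wy']] E1 E2.
    case/negP; apply/imsetP; exists (Ordinal tp) => //.
    apply: edge_inj; rewrite ?esrc_erk ?etgt_erk ?E1 ?E2; congr pair; apply: node_eq;
      rewrite /rung_node //= ; by move: w0 w1; case: (side _).
  rewrite !inE; case/orP: uv => /andP[/eqP <- /eqP <-]; rewrite /src /tgt !rkK;
    by rewrite E.
apply/negP => /(closed_connect cl); rewrite !inE !rkK //.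
Qed.

(** If a rung survives the removal of at most [p] edges, it joins the two shores, each of which is
    still connected. *)
Lemma rungs_unique_min : unique_min_edge_cut src tgt rungs.
Proof.
apply: unique_min_edge_cut_card; first exact: rungs_cut.
rewrite card_rungs => T' T'p /fintype.subsetPn[e /imsetP[t _ ->] eT] u v.
rewrite -(vofK u) -(vofK v) -/(linked T' _ _).
have bridge b b' : linked T' (rung_node b t, None) (rung_node b' t, None).
  have h := joins_linked eT (joins_erk (rung_spec t)).
  by case: b b' => [] [];
    [exact: linked_refl|exact: linked_sym|exact: h|exact: linked_refl].
apply: (linked_trans (vertex_linked T'p _)).
apply: (linked_trans (side_linked T'p (w := (vof u).1)
  (w' := rung_node (side (vof u).1) t) erefl)).
apply: (linked_trans (bridge _ (side (vof v).1))).
apply: (linked_trans (side_linked T'p (w := rung_node (side (vof v).1) t)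
  (w' := (vof v).1) erefl)).
by apply: linked_sym; exact: vertex_linked.
Qed.

End Graph.

(* [lia] without the hypotheses on reals, which it is very slow to discard. *)
Ltac nlia :=
  repeat match goal with H : ?T |- _ => lazymatch T with
    | @eq ?A _ _ =>
        tryif unify A nat then fail else tryif unify A bool then fail else clear H
    | not (@eq nat _ _) => fail
    | is_true (leq _ _) => fail
    | is_true (andb _ _) => fail
    | is_true (negb _) => fail
    | _ => clear H
    end end; lia.

(** * The drawing *)

Section Drawing.
Variables (R : realType) (p K Y : nat) (X : nat -> nat) (a : nat -> R).
Notation node := (node K).
Notation vertex := (vertex p K).
Implicit Types (w : node) (d : dir) (u v y : vertex) (z : pt R).

Hypothesis a0 : a 0%N = 0.
Hypothesis a_mono : forall i j, (i < j <= p.+1)%N -> a i < a j.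
Hypothesis a_ub : forall i, (i <= p.+1)%N -> a i <= 4^-1.
Hypothesis a_gen : no_concurrent p.+1 a.

Definition bx w : nat := (2 * nx w + side w)%N.
Definition by_ w : nat := (2 * ny w + side w)%N.

(** The second component of [d] reverses the axis of the lattice edge but keeps the side on which
    the arc lies. The vertices of index [i] at the two ends are thus at the same height, and the
    track joining them is parallel to the lattice line. *)
Definition rot d z : pt R :=
  let x := if d.2 then - z.1 else z.1 in if d.1 then (z.2, x) else (x, z.2).

Definition at_ w z : pt R := ((bx w)%:R + z.1, (by_ w)%:R + z.2).

Definition pbl (i : nat) : pt R := (a i, a i * a i).

Definition posV v : pt R :=
  at_ v.1 (if v.2 is Some (d, i) then rot d (pbl i.+1) else (0, 0)).

Lemma posV_pv w d i : (i <= p.+1)%N -> posV (pv p w d i) = at_ w (rot d (pbl i)).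
Proof.
case: i => [_|i li]; last by rewrite /posV /= inordK.
rewrite /posV /rot /pbl /= a0 mulr0 oppr0.
by case: d => [[] []].
Qed.

Lemma lerp_at_rot w d (P Q : pt R) t :
  lerp (at_ w (rot d P)) (at_ w (rot d Q)) t = at_ w (rot d (lerp P Q t)).
Proof. by case: d => [[] []]; rewrite /lerp /at_ /rot /=; congr pair; ring. Qed.

Lemma at_inj w : injective (at_ w).
Proof. by move=> [x y] [x' y'] [/addrI /= -> /addrI /= ->]. Qed.

Lemma rot_inj d : injective (rot d).
Proof.
by case: d => [[] []] [x y] [x' y'] [] //= => [-> /oppr_inj->|-> ->|/oppr_inj-> ->|-> ->].
Qed.

Lemma a_le i j : (i <= j)%N -> (j <= p.+1)%N -> a i <= a j.
Proof.
by rewrite leq_eqVlt => /orP[/eqP->//|ij] jp; apply/ltW/a_mono; rewrite ij.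
Qed.

Lemma a_ge0 i : (i <= p.+1)%N -> 0 <= a i.
Proof. by move=> ip; rewrite -a0; exact: a_le. Qed.

Lemma a_inj i j : (i <= p.+1)%N -> (j <= p.+1)%N -> a i = a j -> i = j.
Proof.
move=> li lj E; case: (ltngtP i j) => // lt.
  by have : a i < a j; [apply: a_mono; lia|rewrite E ltxx].
by have : a j < a i; [apply: a_mono; lia|rewrite E ltxx].
Qed.

Lemma a_eq0 i : (i <= p.+1)%N -> a i <= 0 -> i = 0%N.
Proof.
move=> ip le; apply: a_inj => //; rewrite a0; apply/eqP.
by rewrite eq_le le a_ge0.
Qed.

Lemma nat_lt1 (m n : nat) : m%:R - n%:R < 1 :> R -> (m <= n)%N.
Proof. by move=> h; rewrite -ltnS -(ltr_nat R) -natr1; lra. Qed.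

Lemma nat_close (m n : nat) (s t : R) :
  m%:R + s = n%:R + t -> s - t < 1 -> t - s < 1 -> m = n.
Proof.
move=> E h1 h2; apply/eqP; rewrite eqn_leq.
by apply/andP; split; apply: nat_lt1; lra.
Qed.

Lemma node_base_eq w w' : bx w = bx w' -> by_ w = by_ w' -> w = w'.
Proof.
rewrite /bx /by_ => E1 E2.
have E : side w = side w' by move: E1; case: (side w) (side w') => [] []; lia.
by apply: node_eq => //; move: E1 E2; rewrite E; lia.
Qed.

(** Nodes are drawn at points whose coordinates have equal parity. Rough bounds on coordinates
    therefore suffice to identify nodes. *)
Lemma bx_parity w w' : by_ w = by_ w' -> odd (bx w) = odd (bx w').
Proof.
rewrite /bx /by_; case: (side w) (side w') => [] []; lia.
Qed.

Lemma by_parity w w' : bx w = bx w' -> odd (by_ w) = odd (by_ w').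
Proof.
rewrite /bx /by_; case: (side w) (side w') => [] []; lia.
Qed.

Lemma base_parity w : odd (bx w) = odd (by_ w).
Proof. by rewrite /bx /by_; case: (side w); lia. Qed.

Lemma nbr_base o w w' : nbr o w w' ->
  bx w' = (bx w + (if o then 0 else 2))%N /\ by_ w' = (by_ w + (if o then 2 else 0))%N.
Proof.
by rewrite /nbr /bx /by_ => /andP[/eqP->]; case: o => /andP[/eqP-> /eqP->]; lia.
Qed.

Lemma rung_base t w w' : rung Y X t w w' ->
  [/\ bx w' = (bx w + 1)%N, by_ w' = (by_ w + 1)%N, bx w = (2 * X t)%N & by_ w = (2 * Y)%N].
Proof.
rewrite /rung /bx /by_ => /and5P[w0 w1 /eqP-> /eqP-> /andP[/eqP-> /eqP->]].
by rewrite w1 (negbTE w0); split; lia.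
Qed.

(** Normal forms in coordinates local to the source node: a chord is parametrised by its abscissa, a
    track by the distance along the lattice line, at constant height [a i * a i]. *)
Inductive on_spec : vertex -> vertex -> pt R -> Prop :=
| OnClique w d i j x of (i < j <= p.+1)%N & a i <= x <= a j :
    on_spec (pv p w d i) (pv p w d j)
      (at_ w (rot d (x, (a i + a j) * x - a i * a j)))
| OnTrack o w w' i x of nbr o w w' & (i <= p)%N & a i <= x <= 2 - a i :
    on_spec (pv p w (o, false) i) (pv p w' (o, true) i)
      (at_ w (rot (o, false) (x, a i * a i)))
| OnRung t w w' x of (t < p)%N & rung Y X t w w' & 0 <= x <= 1 :
    on_spec (w, None) (w', None) (at_ w (x, x)).

Lemma edge_points u v (t : R) : edge_spec Y X u v -> 0 <= t <= 1 ->
  on_spec u v (lerp (posV u) (posV v) t).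
Proof.
case=> [w d i j ij|o w w' i ww' ip|s w w' sp ww'] /andP[t0 t1].
- rewrite !posV_pv; try lia.
  rewrite lerp_at_rot.
  have -> : lerp (pbl i) (pbl j) t = (a i + t * (a j - a i),
      (a i + a j) * (a i + t * (a j - a i)) - a i * a j).
    by rewrite /lerp /pbl /=; congr pair; ring.
  have lij := a_mono ij.
  by apply: OnClique => //; apply/andP; split; nra.
- rewrite !posV_pv; try lia.
  have -> : lerp (at_ w (rot (o, false) (pbl i))) (at_ w' (rot (o, true) (pbl i))) t
    = at_ w (rot (o, false) (a i + t * (2 - 2 * a i), a i * a i)).
    have [E1 E2] := nbr_base ww'.
    by rewrite /lerp /at_ E1 E2 !natrD; case: o {ww' E1 E2} => /=; congr pair; ring.
  have := a_ub (i := i); have := a_ge0 (i := i).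
  move=> h1 h2; have {}h1 : 0 <= a i by apply: h1; lia.
  have {}h2 : a i <= 4^-1 by apply: h2; lia.
  by apply: OnTrack => //; apply/andP; split; nra.
- have [E1 E2 _ _] := rung_base ww'.
  have -> : lerp (posV (w, None)) (posV (w', None)) t = at_ w (t, t).
    by rewrite /posV /lerp /at_ /= E1 E2 !natrD; congr pair; ring.
  by apply: OnRung sp ww' _; rewrite t0.
Qed.

Definition interleaved (i j k l : nat) : bool :=
  (i < k < j)%N && (j < l)%N || (k < i < l)%N && (l < j)%N.

(** For two tracks, the equations between the bases say that their lattice edges have the same
    midpoint. *)
Inductive crossV : vertex -> vertex -> vertex -> vertex -> Prop :=
| CrossClique w d i j k l of (i < j <= p.+1)%N & (k < l <= p.+1)%N
    & interleaved i j k l :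
    crossV (pv p w d i) (pv p w d j) (pv p w d k) (pv p w d l)
| CrossHV w w' i w1 w1' j of nbr false w w' & nbr true w1 w1' & (i <= p)%N
    & (j <= p)%N & bx w1 = (bx w).+1 & by_ w = (by_ w1).+1 :
    crossV (pv p w (false, false) i) (pv p w' (false, true) i)
      (pv p w1 (true, false) j) (pv p w1' (true, true) j)
| CrossVH w w' i w1 w1' j of nbr false w w' & nbr true w1 w1' & (i <= p)%N
    & (j <= p)%N & bx w1 = (bx w).+1 & by_ w = (by_ w1).+1 :
    crossV (pv p w1 (true, false) j) (pv p w1' (true, true) j)
      (pv p w (false, false) i) (pv p w' (false, true) i).

Lemma crossV_sym u v u' v' : crossV u v u' v' -> crossV u' v' u v.
Proof.
case=> [w d i j k l ij kl U|w w' i w1 w1' j *|w w' i w1 w1' j *].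
- apply: CrossClique => //; by rewrite /interleaved orbC.
- exact: CrossVH.
- exact: CrossHV.
Qed.

(** * Intersections of two edges, by kinds *)

Definition meets u v u' v' z :=
  (exists y, [/\ z = posV y, y = u \/ y = v & y = u' \/ y = v']) \/
  (crossV u v u' v' /\ forall y, (y = u \/ y = v) \/ (y = u' \/ y = v') -> z <> posV y).

Lemma meets_sym u v u' v' z : meets u v u' v' z -> meets u' v' u v z.
Proof.
case=> [[y [zy h h']]|[c h]]; [left; exists y|right]; split=> //.
  exact: crossV_sym.
by move=> y h'; apply: h; case: h'; [right|left].
Qed.

Lemma chord_bounds i j x : (i < j <= p.+1)%N -> a i <= x <= a j ->
  let y := (a i + a j) * x - a i * a j in
  [/\ 0 <= x, x <= 4^-1, x * x <= y & y <= x / 4].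
Proof.
move=> ij /andP[ix xj] y.
have ai0 : 0 <= a i by apply: a_ge0; lia.
have aj4 : a j <= 4^-1 by apply: a_ub; lia.
have x0 : 0 <= x by lra.
have h1 : 0 <= (x - a i) * (a j - x) by apply: mulr_ge0; lra.
have h2 : 0 <= a i * (a j - x) by apply: mulr_ge0; lra.
have h3 : 0 <= x * (4^-1 - a j) by apply: mulr_ge0; lra.
split; rewrite /y; nra.
Qed.

Lemma chord_on_parabola i j x :
  (a i + a j) * x - a i * a j = x * x -> x = a i \/ x = a j.
Proof.
move=> E; have /eqP : (x - a i) * (a j - x) = 0 by lra.
by rewrite mulf_eq0 !subr_eq0 => /orP[/eqP->|/eqP<-]; [left|right].
Qed.

(* The cliques at a node lie in four cones that only share their apex. *)
Lemma cones_disjoint d d1 z z1 : d != d1 -> rot d z = rot d1 z1 ->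
  0 <= z.2 <= z.1 / 4 -> 0 <= z1.2 <= z1.1 / 4 -> z.1 = 0 /\ z1.1 = 0.
Proof.
by case: d d1 z z1 => [[] []] [[] []] [x y] [x1 y1] //= _ [E1 E2] /andP[? ?] /andP[? ?];
  split; lra.
Qed.

Lemma chord_cone i j x : (i < j <= p.+1)%N -> a i <= x <= a j ->
  0 <= (a i + a j) * x - a i * a j <= x / 4.
Proof.
move=> ij ixj; have [x0 x4 xy yx] := chord_bounds ij ixj.
by rewrite yx andbT (le_trans _ xy) // mulr_ge0.
Qed.

Lemma rot0 d : rot d (0, 0) = (0, 0).
Proof. by case: d => [[] []]; rewrite /rot /= ?oppr0. Qed.

Lemma chord_node w d i j x : x = 0 -> i = 0%N ->
  at_ w (rot d (x, (a i + a j) * x - a i * a j)) = posV (w, None).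
Proof. by move=> -> ->; rewrite a0 mulr0 mul0r subrr rot0. Qed.

Lemma meet_chords w d i j k l x : (i < j <= p.+1)%N -> (k < l <= p.+1)%N ->
  a i <= x <= a j -> a k <= x <= a l ->
  (a i + a j) * x - a i * a j = (a k + a l) * x - a k * a l ->
  ~ (i = k /\ j = l) ->
  meets (pv p w d i) (pv p w d j) (pv p w d k) (pv p w d l)
    (at_ w (rot d (x, (a i + a j) * x - a i * a j))).
Proof.
move=> ij kl /andP[ix xj] /andP[kx xl] E N.
have inj s t : (s <= p.+1)%N -> (t <= p.+1)%N -> s <> t -> a s - a t != 0.
  by move=> ls lt st; rewrite subr_eq0; apply/eqP => /(a_inj ls lt).
have par s : (s <= p.+1)%N -> x = a s -> (s = i \/ s = j) ->
    at_ w (rot d (x, (a i + a j) * x - a i * a j)) = posV (pv p w d s).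
  move=> ls -> h; rewrite posV_pv // /pbl; congr (at_ w (rot d (_, _))).
  by case: h => ->; ring.
have [ik|ik] := eqVneq i k.
  have xi : x = a i.
    subst k; have jl : j <> l by move=> jl; apply: N.
    apply/eqP; rewrite -subr_eq0; apply/eqP; apply: (mulfI (inj j l _ _ jl)); try nlia.
    by rewrite mulr0; lra.
  left; exists (pv p w d i); split; [|by left|by left; rewrite ik].
  by apply: par => //; [nlia|left].
have [jl|jl] := eqVneq j l.
  have xj' : x = a j.
    subst l; apply/eqP; rewrite -subr_eq0; apply/eqP.
    apply: (mulfI (inj i k _ _ (elimN eqP ik))); try nlia.
    by rewrite mulr0; lra.
  left; exists (pv p w d j); split; [|by right|by right; rewrite jl].
  by apply: par => //; [nlia|right].
have [il|il] := eqVneq i l.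
  have xi : x = a i by apply: le_anti; rewrite ix {1}il xl.
  left; exists (pv p w d i); split; [|by left|by right; rewrite il].
  by apply: par => //; [nlia|left].
have [jk|jk] := eqVneq j k.
  have xj' : x = a j by apply: le_anti; rewrite xj {1}jk kx.
  left; exists (pv p w d j); split; [|by right|by left; rewrite jk].
  by apply: par => //; [nlia|right].
right; split.
  (* At [x] a chord is [(x - a s) * (a t - x)] above the parabola, which is strictly larger for the
     outer of two nested chords. *)
  have nested s t s' t' : (s < s')%N -> (s' < t')%N -> (t' < t)%N -> (t <= p.+1)%N ->
      a s' <= x <= a t' ->
      (a s + a t) * x - a s * a t <> (a s' + a t') * x - a s' * a t'.
    move=> ss' st tt' tp /andP[h1 h2] F.
    have A1 : a s < a s' by apply: a_mono; nlia.
    have A2 : a t' < a t by apply: a_mono; nlia.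
    have : 0 < (a s' - a s) * (a t - x) by apply: mulr_gt0; lra.
    have : 0 <= (x - a s') * (a t - a t') by apply: mulr_ge0; lra.
    lra.
  apply: CrossClique => //; apply: contraT; rewrite /interleaved => NI.
  have [jk'|] := ltnP j k.
    have := a_mono (_ : j < k <= p.+1)%N; move=> /(_ ltac:(nlia)); lra.
  have [li'|] := ltnP l i.
    have := a_mono (_ : l < i <= p.+1)%N; move=> /(_ ltac:(nlia)); lra.
  move=> il' jk'; have [ik'|ki'] := ltnP i k.
    by case: (nested i j k l _ _ _ _ _ E); rewrite ?kx //; move: NI; nlia.
  by case: (nested k l i j _ _ _ _ _ (esym E)); rewrite ?ix //; move: NI; nlia.
(* A chord meets the parabola only at its ends, so a vertex of the clique on it is one of them. *)
have out s t r : (s <= p.+1)%N -> (t <= p.+1)%N -> (r <= p.+1)%N ->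
    r <> s -> r <> t ->
    (a s + a t) * x - a s * a t = (a i + a j) * x - a i * a j ->
    at_ w (rot d (x, (a i + a j) * x - a i * a j)) <> posV (pv p w d r).
  move=> ls lt lr rs rt <-; rewrite posV_pv // => /at_inj /rot_inj [-> F].
  have [/(a_inj lr ls)|/(a_inj lr lt)] := chord_on_parabola F; [exact: rs|exact: rt].
by move=> y [[->|->]|[->|->]];
  [apply: (out k l)|apply: (out k l)|apply: (out i j)|apply: (out i j)] => //; nlia.
Qed.

Lemma rot_bounds d z : 0 <= z.2 <= z.1 / 4 -> z.1 <= 4^-1 ->
  [/\ - 4^-1 <= (rot d z).1, (rot d z).1 <= 4^-1,
      - 4^-1 <= (rot d z).2 & (rot d z).2 <= 4^-1].
Proof. by case: d => [[] []] /= /andP[? ?] ?; split; lra. Qed.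

(** Cliques stay within 1/4 of their node, so only cliques of the same node can meet; different
    directions are then separated by their cones. *)
Lemma meet_clique_clique w d i j x w1 d1 k l x1 :
  (i < j <= p.+1)%N -> a i <= x <= a j -> (k < l <= p.+1)%N -> a k <= x1 <= a l ->
  at_ w (rot d (x, (a i + a j) * x - a i * a j)) =
    at_ w1 (rot d1 (x1, (a k + a l) * x1 - a k * a l)) ->
  ~ (pv p w d i = pv p w1 d1 k /\ pv p w d j = pv p w1 d1 l) ->
  meets (pv p w d i) (pv p w d j) (pv p w1 d1 k) (pv p w1 d1 l)
    (at_ w (rot d (x, (a i + a j) * x - a i * a j))).
Proof.
move=> ij ixj kl kxl E N.
have [li lk] : (i <= p.+1)%N /\ (k <= p.+1)%N by nlia.
have c := chord_cone ij ixj; have c1 := chord_cone kl kxl.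
have ww1 : w = w1.
  have [_ x4 _ _] := chord_bounds ij ixj; have [_ x14 _ _] := chord_bounds kl kxl.
  have := @rot_bounds d (x, _) c x4; have := @rot_bounds d1 (x1, _) c1 x14.
  move: E; rewrite /at_; move: (rot d _) (rot d1 _).
  move=> r r1 [E1 E2] [? ? ? ?] [? ? ? ?].
  apply: node_base_eq; [apply: nat_close E1 _ _|apply: nat_close E2 _ _];
    clear N c c1; lra.
subst w1; move/at_inj: E => E.
have [dd1|dd1] := eqVneq d d1.
  subst d1; move/rot_inj: E => -[Ex Ey]; subst x1.
  by apply: meet_chords => //; case=> [? ?]; subst; apply: N.
have [xz x1z] := cones_disjoint dd1 E c c1; rewrite /= in xz x1z.
have i0 : i = 0%N by apply: a_eq0 => //; rewrite -xz; case/andP: ixj.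
have k0 : k = 0%N by apply: a_eq0 => //; rewrite -x1z; case/andP: kxl.
left; exists (w, None); rewrite i0 k0; split; [|by left|by left].
by rewrite -i0; exact: chord_node.
Qed.

(* A track starts outside the parabola, so it meets a clique only at its own
   endpoint or at the node. *)
Lemma meet_clique_track_end w d i j x o n r s :
  (i < j <= p.+1)%N -> a i <= x <= a j -> (r <= p)%N -> a r <= s ->
  rot d (x, (a i + a j) * x - a i * a j) = rot (o, n) (s, a r * a r) ->
  exists y, [/\ at_ w (rot d (x, (a i + a j) * x - a i * a j)) = posV y,
    y = pv p w d i \/ y = pv p w d j & y = pv p w (o, n) r].
Proof.
move=> ij ixj rp rs E.
have li : (i <= p.+1)%N by nlia.
have [x0 x4 xy yx] := chord_bounds ij ixj.
have r0 : 0 <= a r by apply: a_ge0; nlia.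
have r4 : a r <= 4^-1 by apply: a_ub; nlia.
have rr0 : 0 <= a r * a r by apply: mulr_ge0.
have rr4 : a r * a r <= s / 4.
  by have : 0 <= a r * (4^-1 - a r) by [apply: mulr_ge0; lra]; nra.
have [dd1|dd1] := eqVneq d (o, n).
  subst d; move/rot_inj: E => -[Ex Ey]; subst s.
  have h : 0 <= (x - a r) * (x + a r) by apply: mulr_ge0; lra.
  have F : (a i + a j) * x - a i * a j = x * x by lra.
  have xr : x = a r by have : (x - a r) * (x + a r) = 0 by [lra]; nra.
  exists (pv p w (o, n) r); split=> //.
    by rewrite posV_pv ?Ey ?xr //; nlia.
  by have [G|G] := chord_on_parabola F; [left|right]; congr pv;
    apply: a_inj; rewrite -?xr ?G //; nlia.
have c := chord_cone ij ixj.
have c1 : 0 <= a r * a r <= s / 4 by rewrite rr0.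
have [xz sz] := cones_disjoint dd1 E c c1; rewrite /= in xz sz.
have i0 : i = 0%N by apply: a_eq0 => //; rewrite -xz; case/andP: ixj.
have r00 : r = 0%N by apply: a_eq0; [nlia|lra].
exists (w, None); rewrite i0 r00; split; [|by left|by []].
by rewrite -i0; exact: chord_node.
Qed.

Lemma meet_clique_track w d i j x o w1 w1' r s :
  (i < j <= p.+1)%N -> a i <= x <= a j -> nbr o w1 w1' -> (r <= p)%N ->
  a r <= s <= 2 - a r ->
  at_ w (rot d (x, (a i + a j) * x - a i * a j)) =
    at_ w1 (rot (o, false) (s, a r * a r)) ->
  meets (pv p w d i) (pv p w d j) (pv p w1 (o, false) r) (pv p w1' (o, true) r)
    (at_ w (rot d (x, (a i + a j) * x - a i * a j))).
Proof.
move=> ij ixj ww1 rp /andP[rs sr] E.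
have c := chord_cone ij ixj; have [x0 x4 _ _] := chord_bounds ij ixj.
have r0 : 0 <= a r by apply: a_ge0; nlia.
have r4 : a r <= 4^-1 by apply: a_ub; nlia.
have rr0 : 0 <= a r * a r by apply: mulr_ge0.
have rr4 : a r * a r <= 16^-1.
  by have : 0 <= (a r + 4^-1) * (4^-1 - a r) by [apply: mulr_ge0; lra]; nra.
have [F1 F2] := nbr_base ww1.
(* The clique is close to the lattice edge, and parity excludes a node at the midpoint of that
   edge. *)
have [G|G] : w = w1 \/ w = w1'.
  move: E; rewrite /at_ => -[E1 E2]; move: c => /andP[c1 c2].
  case: o ww1 F1 F2 E1 E2 => ww1 F1 F2 /= E1 E2.
    have B : bx w = bx w1.
      by apply: nat_close E1 _ _; case: d {E2} => [[] []] /=; lra.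
    have L1 : (by_ w1 <= by_ w)%N.
      by apply: nat_lt1; move: E2; case: d {E1} => [[] []] /=; lra.
    have L2 : (by_ w <= by_ w1 + 2)%N.
      by apply: nat_lt1; move: E2; rewrite natrD; case: d {E1} => [[] []] /=; lra.
    have := by_parity B; move=> O.
    have [G|G] : by_ w = by_ w1 \/ by_ w = (by_ w1 + 2)%N by nlia.
      by left; apply: node_base_eq.
    by right; apply: node_base_eq; nlia.
  have B : by_ w = by_ w1.
    by apply: nat_close E2 _ _; case: d {E1} => [[] []] /=; lra.
  have L1 : (bx w1 <= bx w)%N.
    by apply: nat_lt1; move: E1; case: d {E2} => [[] []] /=; lra.
  have L2 : (bx w <= bx w1 + 2)%N.
    by apply: nat_lt1; move: E1; rewrite natrD; case: d {E2} => [[] []] /=; lra.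
  have := bx_parity B; move=> O.
  have [G|G] : bx w = bx w1 \/ bx w = (bx w1 + 2)%N by nlia.
    by left; apply: node_base_eq.
  by right; apply: node_base_eq; nlia.
  subst w1; move/at_inj: E => E.
  have [y [zy h h']] := @meet_clique_track_end w _ _ _ _ _ _ _ _ ij ixj rp rs E.
  by left; exists y; split=> //; left.
subst w1'.
have rs' : a r <= 2 - s by lra.
(* The same point of the track seen from its other end, at distance [2 - s]. *)
have E' : rot d (x, (a i + a j) * x - a i * a j) = rot (o, true) (2 - s, a r * a r).
  apply: (@at_inj w); rewrite E /at_ F1 F2 !natrD.
  by case: o {ww1 F1 F2 E} => /=; congr pair; ring.
have [y [zy h h']] := @meet_clique_track_end w _ _ _ _ _ _ _ _ ij ixj rp rs' E'.
by left; exists y; split=> //; right.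
Qed.

(** A diagonal meets the flat cones along the axes only at their apex. *)
Lemma meet_clique_rung w d i j x t w1 w1' s :
  (i < j <= p.+1)%N -> a i <= x <= a j -> rung Y X t w1 w1' -> 0 <= s <= 1 ->
  at_ w (rot d (x, (a i + a j) * x - a i * a j)) = at_ w1 (s, s) ->
  meets (pv p w d i) (pv p w d j) (w1, None) (w1', None)
    (at_ w (rot d (x, (a i + a j) * x - a i * a j))).
Proof.
move=> ij ixj ww1 /andP[s0 s1] E.
have li : (i <= p.+1)%N by nlia.
have /andP[c1 c2] := chord_cone ij ixj; have [x0 x4 _ _] := chord_bounds ij ixj.
have [F1 F2 _ _] := rung_base ww1.
have E1 := congr1 fst E; have E2 := congr1 snd E; rewrite /= in E1 E2.
have L1 : (bx w1 <= bx w)%N.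
  by apply: nat_lt1; move: E1; case: d {E E2} => [[] []] /=; lra.
have L2 : (bx w <= bx w1 + 1)%N.
  by apply: nat_lt1; move: E1; rewrite natrD; case: d {E E2} => [[] []] /=; lra.
have L3 : (by_ w1 <= by_ w)%N.
  by apply: nat_lt1; move: E2; case: d {E E1} => [[] []] /=; lra.
have L4 : (by_ w <= by_ w1 + 1)%N.
  by apply: nat_lt1; move: E2; rewrite natrD; case: d {E E1} => [[] []] /=; lra.
have O := base_parity w; have O1 := base_parity w1.
have x00 : x = 0 -> i = 0%N by move=> xz; apply: a_eq0 => //; rewrite -xz; case/andP: ixj.
have fin y : x = 0 -> y.1 = w -> y.2 = None -> (y = (w1, None) \/ y = (w1', None)) ->
  meets (pv p w d i) (pv p w d j) (w1, None) (w1', None)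
    (at_ w (rot d (x, (a i + a j) * x - a i * a j))).
  move=> xz yw yN h; left; exists y; split=> //; last first.
    by left; rewrite (x00 xz); case: (y) yw yN => ? ? /= -> ->.
  have -> : y = (w, None) by case: (y) yw yN => ? ? /= -> ->.
  by apply: chord_node => //; exact: x00.
have [G|G] : bx w = bx w1 \/ bx w = (bx w1).+1 by nlia.
  have w1w : w = w1 by apply: node_base_eq; nlia.
  subst w1; apply: (fin (w, None)) => //; last by left.
  by move: E1 E2; case: d {E fin} => [[] []] /=; lra.
have w1w : w = w1' by apply: node_base_eq; nlia.
subst w1'; apply: (fin (w, None)) => //; last by right.
by move: E1 E2; rewrite F1 F2 !natrD; case: d {E fin} => [[] []] /=; lra.
Qed.

Lemma square_bound i : (i <= p.+1)%N -> 0 <= a i * a i <= a i / 4.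
Proof.
move=> ip; have h0 := a_ge0 ip; have h1 := a_ub ip.
have : 0 <= a i * (4^-1 - a i) by apply: mulr_ge0; lra.
by move=> h2; apply/andP; split; [exact: mulr_ge0|lra].
Qed.

Lemma square_inj i j : (i <= p.+1)%N -> (j <= p.+1)%N ->
  a i * a i = a j * a j -> i = j.
Proof.
move=> ip jp E; apply: a_inj => //; have h0 := a_ge0 ip; have h1 := a_ge0 jp.
have /eqP : (a i - a j) * (a i + a j) = 0 by lra.
by rewrite mulf_eq0 => /orP[] /eqP; lra.
Qed.

(** Between tracks of index [i] on consecutive lattice edges there is a gap of length [2 * a i]
    around the common node, which closes only for [i = 0]. *)
Lemma meet_track_track_end o w w' i x w1' s :
  nbr o w w' -> (i <= p)%N -> a i <= x <= 2 - a i ->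
  nbr o w' w1' -> a i <= s <= 2 - a i ->
  at_ w (rot (o, false) (x, a i * a i)) = at_ w' (rot (o, false) (s, a i * a i)) ->
  meets (pv p w (o, false) i) (pv p w' (o, true) i)
    (pv p w' (o, false) i) (pv p w1' (o, true) i)
    (at_ w (rot (o, false) (x, a i * a i))).
Proof.
move=> ww' ip /andP[ix xi] ww1 /andP[is_ si] E.
have ai0 : 0 <= a i by apply: a_ge0; nlia.
have [F1 F2] := nbr_base ww'.
have sx : s = 0 /\ a i = 0.
  move: E; rewrite /at_ F1 F2 !natrD; case: o {ww' ww1 F1 F2} => -[/= E1 E2]; lra.
have i0 : i = 0%N by apply: a_eq0; [nlia|lra].
left; exists (w', None); rewrite E i0 a0 sx.1; split; [|by right|by left].
by rewrite mulr0 rot0.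
Qed.

(** Distinct indices have distinct heights, so the two tracks have the same index and lie on equal
    or consecutive edges of one lattice line. *)
Lemma meet_track_track_parallel o w w' i x w1 w1' j s :
  nbr o w w' -> (i <= p)%N -> a i <= x <= 2 - a i ->
  nbr o w1 w1' -> (j <= p)%N -> a j <= s <= 2 - a j ->
  at_ w (rot (o, false) (x, a i * a i)) = at_ w1 (rot (o, false) (s, a j * a j)) ->
  ~ (pv p w (o, false) i = pv p w1 (o, false) j /\
     pv p w' (o, true) i = pv p w1' (o, true) j) ->
  meets (pv p w (o, false) i) (pv p w' (o, true) i)
    (pv p w1 (o, false) j) (pv p w1' (o, true) j)
    (at_ w (rot (o, false) (x, a i * a i))).
Proof.
move=> ww' ip xi ww1 jp sj E N.
have ip1 : (i <= p.+1)%N by nlia.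
have jp1 : (j <= p.+1)%N by nlia.
have /andP[q1 q2] := square_bound ip1; have /andP[q3 q4] := square_bound jp1.
have u1 := a_ub ip1; have u2 := a_ub jp1.
have v1 := a_ge0 ip1; have v2 := a_ge0 jp1.
move: (xi) (sj) => /andP[x1 x2] /andP[s1 s2].
have [F1 F2] := nbr_base ww'; have [G1 G2] := nbr_base ww1.
have [H ij] : (w = w1 \/ w1 = w' \/ w = w1') /\ i = j.
  move: E F1 F2 G1 G2; rewrite /at_; case: o {N ww' ww1} => -[/= E1 E2] F1 F2 G1 G2.
    have B : bx w = bx w1 by apply: nat_close E1 _ _; lra.
    split; last by apply: square_inj => //; move: E1; rewrite B; lra.
    have L1 : (by_ w1 <= by_ w + 2)%N by apply: nat_lt1; rewrite natrD; lra.
    have L2 : (by_ w <= by_ w1 + 2)%N by apply: nat_lt1; rewrite natrD; lra.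
    have O := by_parity B.
    have [e|[e|e]] : by_ w = by_ w1 \/ by_ w1 = (by_ w + 2)%N \/ by_ w = (by_ w1 + 2)%N by nlia.
    + by left; apply: node_base_eq.
    + by right; left; apply: node_base_eq; nlia.
    + by right; right; apply: node_base_eq; nlia.
  have B : by_ w = by_ w1 by apply: nat_close E2 _ _; lra.
  split; last by apply: square_inj => //; move: E2; rewrite B; lra.
  have L1 : (bx w1 <= bx w + 2)%N by apply: nat_lt1; rewrite natrD; lra.
  have L2 : (bx w <= bx w1 + 2)%N by apply: nat_lt1; rewrite natrD; lra.
  have O := bx_parity B.
  have [e|[e|e]] : bx w = bx w1 \/ bx w1 = (bx w + 2)%N \/ bx w = (bx w1 + 2)%N by nlia.
  + by left; apply: node_base_eq.
  + by right; left; apply: node_base_eq; nlia.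
  + by right; right; apply: node_base_eq; nlia.
subst j; case: H => [H|[H|H]].
- case: N; subst w1; suff -> : w' = w1' by [].
  by apply: node_base_eq; nlia.
- by subst w1; exact: meet_track_track_end E.
- by subst w; rewrite E; apply: meets_sym; apply: (meet_track_track_end ww1) (esym E).
Qed.

Lemma meet_track_track_crossing w w' i x w1 w1' j s :
  nbr false w w' -> (i <= p)%N -> a i <= x <= 2 - a i ->
  nbr true w1 w1' -> (j <= p)%N -> a j <= s <= 2 - a j ->
  at_ w (rot (false, false) (x, a i * a i)) =
    at_ w1 (rot (true, false) (s, a j * a j)) ->
  meets (pv p w (false, false) i) (pv p w' (false, true) i)
    (pv p w1 (true, false) j) (pv p w1' (true, true) j)
    (at_ w (rot (false, false) (x, a i * a i))).
Proof.
move=> ww' ip /andP[x1 x2] ww1 jp /andP[s1 s2] E.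
have ip1 : (i <= p.+1)%N by nlia.
have jp1 : (j <= p.+1)%N by nlia.
have /andP[q1 q2] := square_bound ip1; have /andP[q3 q4] := square_bound jp1.
have u1 := a_ub ip1; have u2 := a_ub jp1.
have v1 := a_ge0 ip1; have v2 := a_ge0 jp1.
have [F1 F2] := nbr_base ww'; have [G1 G2] := nbr_base ww1.
have E1 := congr1 fst E; have E2 := congr1 snd E; rewrite /= in E1 E2.
have L1 : (bx w <= bx w1)%N by apply: nat_lt1; lra.
have L2 : (bx w1 <= bx w + 2)%N by apply: nat_lt1; rewrite natrD; lra.
have L3 : (by_ w1 <= by_ w)%N by apply: nat_lt1; lra.
have L4 : (by_ w <= by_ w1 + 2)%N by apply: nat_lt1; rewrite natrD; lra.
have O := base_parity w; have O1 := base_parity w1.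
have [e|e] := eqVneq (bx w1) (bx w).+1.
  have e' : by_ w = (by_ w1).+1 by nlia.
  right; split; first exact: CrossHV.
  rewrite e -natr1 in E1; rewrite e' -natr1 in E2.
  move=> y [[]|[]] ->; rewrite posV_pv //.
  - by move=> -[/=]; lra.
  - by move=> -[/=]; rewrite F1 natrD; lra.
  - by move=> -[/= _]; rewrite e' -natr1; lra.
  - by move=> -[/= _]; rewrite e' -natr1 G2 natrD; lra.
(* By parity the two lattice edges now have a common node. Near it each height is at most a quarter
   of the distance along the track, so both tracks have index 0. *)
have ai0 : a i = 0 /\ a j = 0.
  have [b|b] : bx w1 = bx w \/ bx w1 = (bx w + 2)%N by nlia.
    have [b'|b'] : by_ w = by_ w1 \/ by_ w = (by_ w1 + 2)%N by nlia.
      by move: E1 E2; rewrite b b'; split; lra.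
    by move: E1 E2; rewrite b b' natrD; split; lra.
  have [b'|b'] : by_ w = by_ w1 \/ by_ w = (by_ w1 + 2)%N by nlia.
    by move: E1 E2; rewrite b b' natrD; split; lra.
  by move: E1 E2; rewrite b b' !natrD; split; lra.
case: ai0 => ai0 aj0.
have i0 : i = 0%N by apply: a_eq0; [nlia|lra].
have j0 : j = 0%N by apply: a_eq0; [nlia|lra].
rewrite i0 j0 a0 mulr0.
have V (y : node) : y = w \/ y = w' -> y = w1 \/ y = w1' ->
    at_ w (rot (false, false) (x, 0)) = at_ y (0, 0) ->
  meets (pv p w (false, false) 0) (pv p w' (false, true) 0)
    (pv p w1 (true, false) 0) (pv p w1' (true, true) 0)
    (at_ w (rot (false, false) (x, 0))).
  move=> h h' zy; left; exists (y, None); split=> //.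
    by case: h => ->; [left|right].
  by case: h' => ->; [left|right].
have [b|b] : bx w1 = bx w \/ bx w1 = (bx w + 2)%N by nlia.
  apply: (V w); first by left.
    have [b'|b'] : by_ w = by_ w1 \/ by_ w = (by_ w1 + 2)%N by nlia.
      by left; apply: node_base_eq.
    by right; apply: node_base_eq; nlia.
  by move: E1; rewrite b aj0 => E1; rewrite /at_ /=; congr pair; lra.
apply: (V w'); first by right.
  have [b'|b'] : by_ w = by_ w1 \/ by_ w = (by_ w1 + 2)%N by nlia.
    by left; apply: node_base_eq; nlia.
  by right; apply: node_base_eq; nlia.
by move: E1; rewrite b natrD aj0 => E1; rewrite /at_ F1 F2 addn0 natrD /=; congr pair; lra.
Qed.

(** Seen from either end, the height of a point of a track is at most a quarter of its distance
    along the lattice line, so a diagonal can meet it only at a node. *)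
Lemma meet_track_rung o w w' i x t w1 w1' s :
  nbr o w w' -> (i <= p)%N -> a i <= x <= 2 - a i ->
  rung Y X t w1 w1' -> 0 <= s <= 1 ->
  at_ w (rot (o, false) (x, a i * a i)) = at_ w1 (s, s) ->
  meets (pv p w (o, false) i) (pv p w' (o, true) i) (w1, None) (w1', None)
    (at_ w (rot (o, false) (x, a i * a i))).
Proof.
move=> ww' ip /andP[x1 x2] ww1 /andP[s0 s1] E.
have ip1 : (i <= p.+1)%N by nlia.
have /andP[q1 q2] := square_bound ip1.
have u1 := a_ub ip1; have v1 := a_ge0 ip1.
have [F1 F2] := nbr_base ww'; have [G1 G2 _ _] := rung_base ww1.
have O := base_parity w; have O1 := base_parity w1.
have V (y : node) : a i = 0 -> y = w \/ y = w' -> y = w1 \/ y = w1' ->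
    at_ w (rot (o, false) (x, 0)) = at_ y (0, 0) ->
  meets (pv p w (o, false) i) (pv p w' (o, true) i)
    (w1, None) (w1', None) (at_ w (rot (o, false) (x, a i * a i))).
  move=> ai0 h h'; have -> : i = 0%N by apply: a_eq0; [nlia|lra].
  rewrite a0 mulr0 => zy; left; exists (y, None); split=> //.
    by case: h => ->; [left|right].
  by case: h' => ->; [left|right].
have W (y : node) : a i = 0 -> bx y = bx w1 /\ by_ y = by_ w1 /\ s = 0 \/
    bx y = bx w1' /\ by_ y = by_ w1' /\ s = 1 -> y = w \/ y = w' ->
  meets (pv p w (o, false) i) (pv p w' (o, true) i)
    (w1, None) (w1', None) (at_ w (rot (o, false) (x, a i * a i))).
  move=> ai0 h yw; apply: (V y) => //.
    by case: h => -[h1 [h2 _]]; [left|right]; apply: node_base_eq.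
  move: E; rewrite ai0 mulr0 => ->.
  case: h => -[h1 [h2 ->]]; first by rewrite /at_ h1 h2.
  by rewrite /at_ h1 h2 G1 G2 !natrD /=; congr pair; ring.
case: o ww' F1 F2 V W E => ww' F1 F2 V W E;
  have E1 := congr1 fst E; have E2 := congr1 snd E; rewrite /= in E1 E2.
  have L1 : (bx w1 <= bx w)%N by apply: nat_lt1; lra.
  have L2 : (bx w <= bx w1 + 1)%N by apply: nat_lt1; rewrite natrD; lra.
  have L3 : (by_ w <= by_ w1 + 1)%N by apply: nat_lt1; rewrite natrD; lra.
  have L4 : (by_ w1 <= by_ w + 2)%N by apply: nat_lt1; rewrite natrD; lra.
  have [b|b] : bx w = bx w1 \/ bx w = (bx w1 + 1)%N by nlia.
    have [b'|b'] : by_ w1 = by_ w \/ by_ w1 = (by_ w + 2)%N by nlia.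
      by rewrite b b' in E1 E2; apply: (W w); [lra|left; split=> //; split=> //; lra|left].
    rewrite b b' natrD in E1 E2; apply: (W w'); [lra|left|by right].
    by split; [nlia|split; [nlia|lra]].
  have [b'|b'] : by_ w = (by_ w1 + 1)%N \/ by_ w1 = (by_ w + 1)%N by nlia.
    rewrite b natrD in E1; rewrite b' natrD in E2.
    by apply: (W w); [lra|right; split; [nlia|split; [nlia|lra]]|left].
  rewrite b natrD in E1; rewrite b' natrD in E2.
  by apply: (W w'); [lra|right; split; [nlia|split; [nlia|lra]]|right].
have L1 : (by_ w1 <= by_ w)%N by apply: nat_lt1; lra.
have L2 : (by_ w <= by_ w1 + 1)%N by apply: nat_lt1; rewrite natrD; lra.
have L3 : (bx w <= bx w1 + 1)%N by apply: nat_lt1; rewrite natrD; lra.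
have L4 : (bx w1 <= bx w + 2)%N by apply: nat_lt1; rewrite natrD; lra.
have [b|b] : by_ w = by_ w1 \/ by_ w = (by_ w1 + 1)%N by nlia.
  have [b'|b'] : bx w1 = bx w \/ bx w1 = (bx w + 2)%N by nlia.
    by rewrite b b' in E1 E2; apply: (W w); [lra|left; split=> //; split=> //; lra|left].
  rewrite b b' natrD in E1 E2; apply: (W w'); [lra|left|by right].
  by split; [nlia|split; [nlia|lra]].
have [b'|b'] : bx w = (bx w1 + 1)%N \/ bx w1 = (bx w + 1)%N by nlia.
  rewrite b natrD in E2; rewrite b' natrD in E1.
  by apply: (W w); [lra|right; split; [nlia|split; [nlia|lra]]|left].
rewrite b natrD in E2; rewrite b' natrD in E1.
by apply: (W w'); [lra|right; split; [nlia|split; [nlia|lra]]|right].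
Qed.

(** All rungs start at the same ordinate, so a common point has the same parameter on both. *)
Lemma meet_rung_rung t w w' x t1 w1 w1' s :
  rung Y X t w w' -> rung Y X t1 w1 w1' -> at_ w (x, x) = at_ w1 (s, s) ->
  w = w1 /\ w' = w1'.
Proof.
move=> /rung_base[F1 F2 F3 F4] /rung_base[G1 G2 G3 G4] [/= E1 E2].
have xs : x = s by move: E2; rewrite F4 G4; lra.
have B : bx w = bx w1 by apply/eqP; rewrite -(eqr_nat R); apply/eqP; lra.
by split; apply: node_base_eq; nlia.
Qed.

Lemma on_spec_meets u v u' v' z : on_spec u v z -> on_spec u' v' z ->
  ~ (u = u' /\ v = v') -> meets u v u' v' z.
Proof.
move=> [w d i j x ij ixj|o w w' i x ww' ip xi|t w w' x tp ww' x01] h N.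
- move E : (at_ w _) h N => z1 h N; rewrite -E.
  case: h E N => [w1 d1 k l x1 kl kxl|o w1 w1' k x1 ww1 kp kx|t w1 w1' x1 tp ww1 x01] E N.
  + exact: (meet_clique_clique ij ixj kl kxl E N).
  + exact: (meet_clique_track ij ixj ww1 kp kx E).
  + exact: (meet_clique_rung ij ixj ww1 x01 E).
- move E : (at_ w _) h N => z1 h N; rewrite -E.
  case: h E N => [w1 d1 k l x1 kl kxl|o1 w1 w1' k x1 ww1 kp kx|t w1 w1' x1 tp ww1 x01] E N.
  + by apply: meets_sym; rewrite E; exact: (meet_clique_track kl kxl ww' ip xi (esym E)).
  + have [oo|oo] := eqVneq o o1.
      by subst o1; exact: (meet_track_track_parallel ww' ip xi ww1 kp kx E N).
    case: o o1 ww' ww1 E N oo => [] [] // ww' ww1 E N _;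
      last exact: (meet_track_track_crossing ww' ip xi ww1 kp kx E).
    by apply: meets_sym; rewrite E;
      exact: (meet_track_track_crossing ww1 kp kx ww' ip xi (esym E)).
  + exact: (meet_track_rung ww' ip xi ww1 x01 E).
- move E : (at_ w _) h N => z1 h N; rewrite -E.
  case: h E N => [w1 d1 k l x1 kl kxl
    |o1 w1 w1' k x1 ww1 kp kx|t1 w1 w1' x1 t1p ww1 x101] E N.
  + by apply: meets_sym; rewrite E; exact: (meet_clique_rung kl kxl ww' x01 (esym E)).
  + by apply: meets_sym; rewrite E; exact: (meet_track_rung ww1 kp kx ww' x01 (esym E)).
  + by case: N; have [-> ->] := meet_rung_rung ww' ww1 E.
Qed.

Lemma rot_cone_fst d d1 z z1 : rot d z = rot d1 z1 ->
  0 <= z.2 <= z.1 / 4 -> 0 <= z1.2 <= z1.1 / 4 -> z.1 = z1.1.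
Proof.
move=> E c c1; have [dd1|dd1] := eqVneq d d1.
  by move: E; rewrite dd1 => /rot_inj ->.
by have [-> ->] := cones_disjoint dd1 E c c1.
Qed.

Lemma posV_inj : injective posV.
Proof.
have pvP v : exists w d i, (i <= p.+1)%N /\ v = pv p w d i.
  have [[w ->]|[w [d [i [ip ->]]]]] := vertexP v; last by exists w, d, i.+1.
  by exists w, (false, false), 0%N.
move=> u v.
have [w [d [i [ip ->]]]] := pvP u; have [w' [d' [j [jp ->]]]] := pvP v.
rewrite !posV_pv // => E.
have c := square_bound ip; have c' := square_bound jp.
have ai4 := a_ub ip; have aj4 := a_ub jp.
have ww' : w = w'.
  have := rot_bounds d (z := pbl i) c ai4.
  have := rot_bounds d' (z := pbl j) c' aj4.
  move: E; rewrite /at_; move: (rot d _) (rot d' _).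
  move=> r r' [E1 E2] [? ? ? ?] [? ? ? ?].
  by apply: node_base_eq; [apply: nat_close E1 _ _|apply: nat_close E2 _ _]; lra.
subst w'; move/at_inj: E => E.
have ij : i = j by apply: a_inj => //; exact: rot_cone_fst E c c'.
subst j; have [->//|dd'] := eqVneq d d'.
have [i0 _] := cones_disjoint dd' E c c'.
have -> : i = 0%N by apply: a_eq0 => //; rewrite -[X in _ <= X]i0.
by [].
Qed.

(** * Edges that cross a given edge *)

Lemma pv_eq w d i w' d' i' : (i <= p.+1)%N -> (i' <= p.+1)%N ->
  pv p w d i = pv p w' d' i' -> [/\ w = w', i = i' & (0 < i)%N -> d = d'].
Proof.
move=> ip ip' E; have ii' := pv_inj ip ip' E; move: E; rewrite -ii' => E.
by split=> //; [move: E => -[]|move: E; case: (i) => //= n -[] _ ->].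
Qed.

Lemma nbr_neq o w w' : nbr o w w' -> w <> w'.
Proof.
by move=> /nbr_base [E1 E2] E; subst w'; move: E1 E2; case: o; lia.
Qed.

Lemma nbr_orient o o' w w' : nbr o w w' -> nbr o' w w' -> o = o'.
Proof.
move=> /nbr_base [E1 E2] /nbr_base [E3 E4]; move: E1 E2 E3 E4.
by case: o o' => [] []; lia.
Qed.

Lemma nbr_fun o w w' w'' : nbr o w w' -> nbr o w w'' -> w' = w''.
Proof.
move=> /nbr_base [E1 E2] /nbr_base [E3 E4].
by apply: node_base_eq; rewrite ?E1 ?E2 ?E3 ?E4.
Qed.

Lemma cross_clique_inv w d i j u v : (i < j <= p.+1)%N ->
  crossV (pv p w d i) (pv p w d j) u v ->
  exists k l, [/\ (k < l <= p.+1)%N, interleaved i j k l, u = pv p w d k &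
    v = pv p w d l].
Proof.
move=> ij; move E1 : (pv p w d i) => u1; move E2 : (pv p w d j) => u2 c.
have ip : (i <= p.+1)%N by lia.
have jp : (j <= p.+1)%N by lia.
case: c E1 E2 => [w1 d1 i1 j1 k l ij1 kl I
  |w1 w1' i1 w2 w2' j1 n1 n2 h1 h2 e1 e2|w1 w1' i1 w2 w2' j1 n1 n2 h1 h2 e1 e2].
- have ip1 : (i1 <= p.+1)%N by lia.
  have jp1 : (j1 <= p.+1)%N by lia.
  move=> /(pv_eq ip ip1)[ww1 ii1 _] /(pv_eq jp jp1)[_ jj1 dd1].
  by subst w1 i1 j1; have -> : d = d1 by [apply: dd1; lia]; exists k, l.
- by move=> [-> _] [E _]; case: (nbr_neq n1).
- by move=> [-> _] [E _]; case: (nbr_neq n2).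
Qed.

Lemma cross_horizontal_inv w w' i u v : nbr false w w' -> (i <= p)%N ->
  crossV (pv p w (false, false) i) (pv p w' (false, true) i) u v ->
  exists w1 w1' j, [/\ nbr true w1 w1', (j <= p)%N,
    bx w1 = (bx w).+1 /\ by_ w = (by_ w1).+1,
    u = pv p w1 (true, false) j & v = pv p w1' (true, true) j].
Proof.
move=> ww' ip; move E1 : (pv p w _ i) => u1; move E2 : (pv p w' _ i) => u2 c.
case: c E1 E2 => [w1 d1 i1 j1 k l ij1 kl I
  |w1 w1' i1 w2 w2' j1 n1 n2 h1 h2 e1 e2|w1 w1' i1 w2 w2' j1 n1 n2 h1 h2 e1 e2].
- by move=> [E _] [E' _]; case: (nbr_neq ww'); rewrite E E'.
- move=> [ww1 _] [ww1' _]; subst w1 w1'.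
  by exists w2, w2', j1.
- move=> [ww1 _] [ww1' _]; subst.
  by have := nbr_orient ww' n2.
Qed.

Lemma cross_vertical_inv w w' i u v : nbr true w w' -> (i <= p)%N ->
  crossV (pv p w (true, false) i) (pv p w' (true, true) i) u v ->
  exists w1 w1' j, [/\ nbr false w1 w1', (j <= p)%N,
    bx w = (bx w1).+1 /\ by_ w1 = (by_ w).+1,
    u = pv p w1 (false, false) j & v = pv p w1' (false, true) j].
Proof.
move=> ww' ip; move E1 : (pv p w _ i) => u1; move E2 : (pv p w' _ i) => u2 c.
case: c E1 E2 => [w1 d1 i1 j1 k l ij1 kl I
  |w1 w1' i1 w2 w2' j1 n1 n2 h1 h2 e1 e2|w1 w1' i1 w2 w2' j1 n1 n2 h1 h2 e1 e2].
- by move=> [E _] [E' _]; case: (nbr_neq ww'); rewrite E E'.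
- move=> [ww1 _] [ww1' _]; subst.
  by have := nbr_orient ww' n1.
- move=> [ww1 _] [ww1' _]; subst w2 w2'.
  by exists w1, w1', i1.
Qed.

Lemma cross_rung_inv t w w' u v : rung Y X t w w' ->
  ~ crossV (w, None) (w', None) u v.
Proof.
move=> ww'; move E1 : (w, None) => u1; move E2 : (w', None) => u2 c.
have N o : ~ nbr o w w'.
  by move: ww' => /and5P[w0 w1 _ _ _]; rewrite /nbr w1 (negbTE w0).
case: c E1 E2 => [w1 d1 i1 j1 k l ij1 kl I
  |w1 w1' i1 w2 w2' j1 n1 n2 h1 h2 e1 e2|w1 w1' i1 w2 w2' j1 n1 n2 h1 h2 e1 e2].
- by move=> _; case: j1 ij1 I => [|j1] //=; lia.
- by move=> [ww1 _] [ww1' _]; subst; exact: N n1.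
- by move=> [ww1 _] [ww1' _]; subst; exact: N n2.
Qed.

Lemma cross_prod_at w w1 (P Q : pt R) (P1 Q1 : pt R) :
  cross_prod (at_ w P) (at_ w Q) (at_ w1 P1) (at_ w1 Q1) = cross_prod P Q P1 Q1.
Proof. by rewrite /cross_prod /at_ /=; ring. Qed.

Lemma crossV_transversal u v u' v' : crossV u v u' v' ->
  cross_prod (posV u) (posV v) (posV u') (posV v') != 0.
Proof.
have HV w w' i w1 w1' j : nbr false w w' -> nbr true w1 w1' -> (i <= p)%N ->
    (j <= p)%N ->
    0 < cross_prod (posV (pv p w (false, false) i)) (posV (pv p w' (false, true) i))
      (posV (pv p w1 (true, false) j)) (posV (pv p w1' (true, true) j)).
  move=> /nbr_base[E1 E2] /nbr_base[E3 E4] ip jp.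
  have ip1 : (i <= p.+1)%N by lia.
  have jp1 : (j <= p.+1)%N by lia.
  have := a_ub ip1; have := a_ub jp1 => uj ui.
  rewrite !posV_pv // /cross_prod /at_ /= E1 E2 E3 E4 !natrD.
  have : 0 < (2 - 2 * a i) * (2 - 2 * a j) by apply: mulr_gt0; lra.
  by congr (_ < _); ring.
case=> [w d i j k l ij kl I|w w' i w1 w1' j n1 n2 h1 h2 _ _
  |w w' i w1 w1' j n1 n2 h1 h2 _ _].
- have [ip jp kp lp] : [/\ i <= p.+1, j <= p.+1, k <= p.+1 & l <= p.+1]%N by split; lia.
  rewrite !posV_pv // cross_prod_at.
  have aij := a_mono ij; have akl := a_mono kl.
  have S : a k + a l - (a i + a j) != 0.
    move: I; rewrite /interleaved => /orP[] /andP[/andP[h1 h2] h3].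
      have := a_mono (_ : i < k <= p.+1)%N; have := a_mono (_ : j < l <= p.+1)%N.
      by move=> /(_ ltac:(lia)) ? /(_ ltac:(lia)) ?; apply/eqP; lra.
    have := a_mono (_ : k < i <= p.+1)%N; have := a_mono (_ : l < j <= p.+1)%N.
    by move=> /(_ ltac:(lia)) ? /(_ ltac:(lia)) ?; apply/eqP; lra.
  have : (a j - a i) * (a l - a k) * (a k + a l - (a i + a j)) != 0.
    by apply: mulf_neq0 => //; apply: mulf_neq0; rewrite subr_eq0 gt_eqF.
  by rewrite /cross_prod; case: d => [[] []] /= N; apply: contraNneq N => E;
    apply/eqP; lra.
- by rewrite gt_eqF // HV.
- rewrite /cross_prod; apply/eqP; have := HV _ _ _ _ _ _ n1 n2 h1 h2.
  by rewrite /cross_prod; lra.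
Qed.

(** Two edges crossing the same track are parallel tracks, and rungs are not crossed. This leaves
    three chords of one clique, whose six ends are distinct by interleaving. *)
Lemma crossV_no_triple u v u1 v1 u2 v2 (s s1 s2 : R) :
  edge_spec Y X u v ->
  lerp (posV u) (posV v) s = lerp (posV u1) (posV v1) s1 ->
  lerp (posV u) (posV v) s = lerp (posV u2) (posV v2) s2 ->
  crossV u v u1 v1 -> crossV u v u2 v2 -> crossV u1 v1 u2 v2 -> False.
Proof.
case=> [w d i j ij|[] w w' i ww' ip|t w w' tp ww'] Ez1 Ez2.
- move=> /(cross_clique_inv ij)[k [l [kl I1 ? ?]]].
  move=> /(cross_clique_inv ij)[k2 [l2 [kl2 I2 ? ?]]]; subst u1 v1 u2 v2.
  move=> /(cross_clique_inv kl)[k3 [l3 [kl3 I3 E3 E4]]].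
  have [lk2 ll2 lk3 ll3] : [/\ k2 <= p.+1, l2 <= p.+1, k3 <= p.+1 & l3 <= p.+1]%N.
    by split; lia.
  have [_ E5 _] := pv_eq lk2 lk3 E3; have [_ E6 _] := pv_eq ll2 ll3 E4.
  subst k3 l3.
  have line i1 i2 t : (i1 < i2 <= p.+1)%N ->
      exists x, lerp (posV (pv p w d i1)) (posV (pv p w d i2)) t =
        at_ w (rot d (x, (a i1 + a i2) * x - a i1 * a i2)).
    move=> lt; rewrite !posV_pv; try lia.
    rewrite lerp_at_rot; exists (a i1 + t * (a i2 - a i1)).
    by congr (at_ w (rot d _)); rewrite /lerp /pbl /=; congr pair; ring.
  have [x Ex] := line i j s ij; have [x1 Ex1] := line k l s1 kl.
  have [x2 Ex2] := line k2 l2 s2 kl2.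
  move: Ez1 Ez2; rewrite Ex Ex1 Ex2 => /at_inj /rot_inj [xx1 F1] /at_inj /rot_inj [xx2 F2].
  subst x1 x2.
  have := a_gen (i1 := i) (i2 := j) (i3 := k) (i4 := l) (i5 := k2) (i6 := l2).
  have U : uniq [:: i; j; k; l; k2; l2].
    move: I1 I2 I3; rewrite /interleaved /= !inE; clear -ij kl kl2; lia.
  have A : all (fun i => i <= p.+1)%N [:: i; j; k; l; k2; l2] by rewrite /=; lia.
  move=> /(_ U A) /eqP; apply.
  exact: (@conc_eq0 _ _ _ _ _ _ _ x ((a i + a j) * x - a i * a j)).
- move=> /(cross_vertical_inv ww' ip)[w1 [w1' [j [n1 jp _ ? ?]]]].
  move=> /(cross_vertical_inv ww' ip)[w2 [w2' [j2 [n2 jp2 _ ? ?]]]]; subst.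
  move=> /(cross_horizontal_inv n1 jp)[w3 [w3' [j3 [n3 jp3 _ [E _] [E' _]]]]]; subst.
  by have := nbr_orient n2 n3.
- move=> /(cross_horizontal_inv ww' ip)[w1 [w1' [j [n1 jp _ ? ?]]]].
  move=> /(cross_horizontal_inv ww' ip)[w2 [w2' [j2 [n2 jp2 _ ? ?]]]]; subst.
  move=> /(cross_vertical_inv n1 jp)[w3 [w3' [j3 [n3 jp3 _ [E _] [E' _]]]]]; subst.
  by have := nbr_orient n2 n3.
- by move=> /(cross_rung_inv ww').
Qed.

(** * The drawing is k-plane *)

Definition pos (v : 'I_(nV p K)) : pt R := posV (vof v).
Definition drawn (e : 'I_(nE p K Y X)) : R -> pt R :=
  straight (@src p K Y X) (@tgt p K Y X) pos e.
Definition crosses (e f : 'I_(nE p K Y X)) : Prop :=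
  crossV (esrc e) (etgt e) (esrc f) (etgt f).

Lemma drawnE e t : drawn e t = lerp (posV (esrc e)) (posV (etgt e)) t.
Proof. by rewrite /drawn /straight /pos /src /tgt !rkK. Qed.

Lemma pos_inj : injective pos.
Proof. by move=> u v /posV_inj /(can_inj (@vofK _ _)). Qed.

Lemma drawn_int e z : img drawn e z -> z <> posV (esrc e) -> z <> posV (etgt e) ->
  img_int drawn e z.
Proof.
move=> [t /andP[t0 t1] <-] N0 N1; exists t => //; apply/andP; split.
  rewrite lt_neqAle t0 andbT; apply/eqP => E; apply: N0.
  by rewrite drawnE -E lerp0.
rewrite lt_neqAle t1 andbT; apply/eqP => E; apply: N1.
by rewrite drawnE E lerp1.
Qed.

Lemma drawn_on e z : img drawn e z -> on_spec (esrc e) (etgt e) z.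
Proof. by move=> [t t01 <-]; rewrite drawnE; apply: edge_points => //; exact: edgeP. Qed.

Lemma drawn_meet e f z : e <> f -> img drawn e z -> img drawn f z ->
  (exists v : 'I_(nV p K), [/\ z = pos v, v = src e \/ v = tgt e & v = src f \/ v = tgt f])
  \/ [/\ crosses e f, img_int drawn e z & img_int drawn f z].
Proof.
move=> ef ez fz.
have N : ~ (esrc e = esrc f /\ etgt e = etgt f) by move=> [? ?]; apply: ef; exact: edge_inj.
case: (on_spec_meets (drawn_on ez) (drawn_on fz) N) => [[y [zy ye yf]]|[c h]].
  left; exists (rk y); split; first by rewrite /pos rkK.
    by case: ye => ->; [left|right].
  by case: yf => ->; [left|right].
right; split=> //; apply: drawn_int => //; apply: h.
- by left; left.
- by left; right.
- by right; left.
- by right; right.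
Qed.

(** Here [s] and [t] will be the numbers of clique vertices inside and outside the arc cut off by a
    chord; the bound is the inequality of means. *)
Lemma mulr_split_bound (s t k : nat) : (p * p <= 4 * k)%N -> (s + t <= p)%N ->
  (s * t <= k)%N.
Proof.
move=> pk st; have [agm _] := nat_AGM2 s t.
by move: (leq_mul st st) agm; rewrite -mulnn; lia.
Qed.

Lemma few_crossings (k : nat) (e : 'I_(nE p K Y X)) :
  (p * p <= 4 * k)%N -> ((1 < K)%N -> (p.+1 <= k)%N) ->
  (#|[set f : 'I_(nE p K Y X) | `[< crosses e f >]]%SET| <= k)%N.
Proof.
move=> pk pk1.
have cardF (I : finType) (B : {set I}) (F : I -> 'I_(nE p K Y X)) u v :
    (forall f : 'I_(nE p K Y X), crossV u v (esrc f) (etgt f) ->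
      exists2 j, j \in B & f = F j) ->
    (#|[set f : 'I_(nE p K Y X) | `[< crossV u v (esrc f) (etgt f) >]]%SET| <= #|B|)%N.
  move=> h; apply: (@leq_trans #|[set F j | j in B]%SET|); last exact: leq_imset_card.
  apply: subset_leq_card; apply/fintype.subsetP => f; rewrite inE => /asboolP /h[j jB ->].
  exact: imset_f.
have K1 o w w' : nbr o w w' -> (1 < K)%N.
  rewrite /nbr /nx /ny => /andP[_]; have := ltn_ord w'.1.2; have := ltn_ord w'.2.
  by case: o => l1 l2 /andP[/eqP E1 /eqP E2]; lia.
have cardT : #|[set: 'I_p.+1]%SET| = p.+1 by rewrite cardsT card_ord.
rewrite /crosses; case: (edgeP e) => [w d i j ij|[] w w' i ww' ip|t w w' tp ww'].
- pose I := [set s : 'I_p.+2 | (i < s < j)%N]%SET.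
  pose O := [set s : 'I_p.+2 | (s < i)%N || (j < s)%N]%SET.
  have ipp : (i < p.+2)%N by lia.
  have jpp : (j < p.+2)%N by lia.
  pose oi := Ordinal ipp; pose oj := Ordinal jpp.
  have IO : (#|I| + #|O| <= p)%N.
    have dIO : (I :&: O)%SET = finset.set0.
      by apply/setP => s; rewrite !inE; lia.
    rewrite -cardsUI dIO cards0 addn0.
    have S : (I :|: O)%SET \subset ~: [set oi; oj]%SET.
      apply/fintype.subsetP => s; rewrite !inE negb_or -!(inj_eq val_inj) /=; lia.
    have ij' : oi != oj by rewrite -(inj_eq val_inj) /=; lia.
    have := subset_leq_card S; have := cardsC [set oi; oj]%SET.
    by rewrite cards2 ij' card_ord; lia.
  apply: leq_trans (mulr_split_bound pk IO); rewrite -cardsX.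
  (* A crossing chord has one end in [I] and one in [O]. An index of [O] may lie on either side of
     [i] and [j], hence the [minn] and [maxn]; the default [e] is not reached for the pairs that
     come from a crossing edge. *)
  pose F (st : 'I_p.+2 * 'I_p.+2) := xget e [set f : 'I_(nE p K Y X) |
    esrc f = pv p w d (minn st.1 st.2) /\ etgt f = pv p w d (maxn st.1 st.2)].
  apply: (cardF _ _ F) => f /(cross_clique_inv ij)[k' [l' [kl I' Es Et]]].
  have lk : (k' < p.+2)%N by lia.
  have ll : (l' < p.+2)%N by lia.
  have FE st : minn (st : 'I_p.+2 * 'I_p.+2).1 st.2 = k' ->
      maxn st.1 st.2 = l' -> f = F st.
    move=> E1 E2; rewrite /F E1 E2; case: xgetP => [g -> [gs gt]|/(_ f)[]//].
    by apply: edge_inj; rewrite ?Es ?Et ?gs ?gt.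
  move: I'; rewrite /interleaved => /orP[] I'.
    exists (Ordinal lk, Ordinal ll); last by apply: FE => /=; lia.
    by rewrite !inE /=; lia.
  exists (Ordinal ll, Ordinal lk); last by apply: FE => /=; lia.
  by rewrite !inE /=; lia.
- apply: leq_trans (pk1 (K1 _ _ _ ww')); rewrite -cardT.
  pose F (j : 'I_p.+1) := xget e [set f : 'I_(nE p K Y X) | exists w1 w1',
    [/\ nbr false w1 w1', bx w = (bx w1).+1 /\ by_ w1 = (by_ w).+1,
     esrc f = pv p w1 (false, false) j & etgt f = pv p w1' (false, true) j]].
  apply: (cardF _ _ F) =>
    f /(cross_vertical_inv ww' ip)[w1 [w1' [j [n1 jp [b1 b2] Es Et]]]].
  exists (Ordinal (jp : (j < p.+1)%N)); first by rewrite inE.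
  rewrite /F; case: xgetP => [g _ [w2 [w2' [n2 [b3 b4] gs gt]]]|/(_ f)[]].
    have w12 : w1 = w2 by apply: node_base_eq; lia.
    subst w2; have := nbr_fun n1 n2 => w12'; subst w2'.
    by apply: edge_inj; rewrite ?Es ?Et ?gs ?gt.
  by exists w1, w1'.
- apply: leq_trans (pk1 (K1 _ _ _ ww')); rewrite -cardT.
  pose F (j : 'I_p.+1) := xget e [set f : 'I_(nE p K Y X) | exists w1 w1',
    [/\ nbr true w1 w1', bx w1 = (bx w).+1 /\ by_ w = (by_ w1).+1,
     esrc f = pv p w1 (true, false) j & etgt f = pv p w1' (true, true) j]].
  apply: (cardF _ _ F) =>
    f /(cross_horizontal_inv ww' ip)[w1 [w1' [j [n1 jp [b1 b2] Es Et]]]].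
  exists (Ordinal (jp : (j < p.+1)%N)); first by rewrite inE.
  rewrite /F; case: xgetP => [g _ [w2 [w2' [n2 [b3 b4] gs gt]]]|/(_ f)[]].
    have w12 : w1 = w2 by apply: node_base_eq; lia.
    subst w2; have := nbr_fun n1 n2 => w12'; subst w2'.
    by apply: edge_inj; rewrite ?Es ?Et ?gs ?gt.
  by exists w1, w1'.
- rewrite (_ : [set f | _]%SET = finset.set0) ?cards0 //.
  by apply/setP => f; rewrite !inE; apply/asboolP => /(cross_rung_inv ww').
Qed.

Lemma drawn_k_plane (k : nat) :
  (p * p <= 4 * k)%N -> ((1 < K)%N -> (p.+1 <= k)%N) ->
  is_k_plane (@src p K Y X) (@tgt p K Y X) pos drawn k.
Proof.
move=> pk pk1; apply: (@straight_k_plane _ _ _ _ _ _ _ crosses).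
- exact: pos_inj.
- exact: simple_src_tgt.
- exact: incident_edge.
- exact: drawn_meet.
- move=> e f c; rewrite /pos /src /tgt !rkK; exact: crossV_transversal.
- move=> e f g z ef eg fg [s _ Es] [s1 _ E1] [s2 _ E2].
  rewrite -/(drawn e) -/(drawn f) -/(drawn g) !drawnE in Es E1 E2.
  apply: (crossV_no_triple (edgeP e) (s := s) (s1 := s1) (s2 := s2)).
    by rewrite Es E1.
  by rewrite Es E2.
- by move=> e; exact: few_crossings.
Qed.

(** * Faces *)

Notation ds := (drawing_set pos drawn).

Lemma track0_drawn o w w' (t : R) : nbr o w w' -> 0 <= t <= 1 ->
  ds (at_ w (rot (o, false) (2 * t, 0))).
Proof.
move=> ww' t01; right.
have h : edge_spec Y X (pv p w (o, false) 0) (pv p w' (o, true) 0).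
  exact: TrackEdge.
exists (erk h), t; first exact: t01.
rewrite drawnE esrc_erk etgt_erk.
have [E1 E2] := nbr_base ww'.
by rewrite /posV /lerp /at_ E1 E2 !natrD /=; case: (o); rewrite /rot /=; congr pair; ring.
Qed.

Definition cell (i j : nat) : set (pt R) :=
  [set z | 2 * i%:R < z.1 < 2 * i%:R + 2 /\ 2 * j%:R < z.2 < 2 * j%:R + 2].
Definition closed_cell (i j : nat) : set (pt R) :=
  [set z | 2 * i%:R <= z.1 <= 2 * i%:R + 2 /\ 2 * j%:R <= z.2 <= 2 * j%:R + 2].

Lemma horizontal_drawn i j z : (i.+1 < K)%N -> (j < K)%N ->
  2 * i%:R <= z.1 <= 2 * i%:R + 2 -> z.2 = 2 * j%:R -> ds z.
Proof.
move=> iK jK /andP[z1 z2] z3; have iK' : (i < K)%N by exact: ltnW.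
pose w : node := (false, Ordinal iK', Ordinal jK).
pose w' : node := (false, Ordinal iK, Ordinal jK).
have ww' : nbr false w w' by rewrite /nbr /side /nx /ny /= !eqxx.
have -> : z = at_ w (rot (false, false) (2 * ((z.1 - 2 * i%:R) / 2), 0)).
  case: z z1 z2 z3 => x y /= z1 z2 z3.
  by rewrite /at_ /rot /bx /by_ /nx /ny /side /= !addn0 !natrM z3; congr pair; field.
by apply: (track0_drawn ww'); apply/andP; split; lra.
Qed.

Lemma vertical_drawn i j z : (i < K)%N -> (j.+1 < K)%N ->
  z.1 = 2 * i%:R -> 2 * j%:R <= z.2 <= 2 * j%:R + 2 -> ds z.
Proof.
move=> iK jK z3 /andP[z1 z2]; have jK' : (j < K)%N by exact: ltnW.
pose w : node := (false, Ordinal iK, Ordinal jK').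
pose w' : node := (false, Ordinal iK, Ordinal jK).
have ww' : nbr true w w' by rewrite /nbr /side /nx /ny /= !eqxx.
have -> : z = at_ w (rot (true, false) (2 * ((z.2 - 2 * j%:R) / 2), 0)).
  case: z z1 z2 z3 => x y /= z1 z2 z3.
  by rewrite /at_ /rot /bx /by_ /nx /ny /side /= !addn0 !natrM z3; congr pair; field.
by apply: (track0_drawn ww'); apply/andP; split; lra.
Qed.

Lemma closed_cell_undrawn i j z : (i.+1 < K)%N -> (j.+1 < K)%N ->
  closed_cell i j z -> ~ ds z -> cell i j z.
Proof.
move=> iK jK [zi zj] nz; have iK' := ltnW iK; have jK' := ltnW jK.
have h1 : z.1 <> 2 * i%:R by move=> E; apply: nz; exact: vertical_drawn jK E zj.
have h2 : z.1 <> 2 * i%:R + 2.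
  move=> E; apply: nz; apply: (vertical_drawn iK jK _ zj).
  by rewrite E -natr1; ring.
have h3 : z.2 <> 2 * j%:R by move=> E; apply: nz; exact: horizontal_drawn jK' zi E.
have h4 : z.2 <> 2 * j%:R + 2.
  move=> E; apply: nz; apply: (horizontal_drawn iK jK zi).
  by rewrite E -natr1; ring.
move: zi zj => /andP[a1 a2] /andP[a3 a4].
by split; apply/andP; split; rewrite lt_neqAle ?a1 ?a2 ?a3 ?a4 andbT; apply/eqP => // /esym.
Qed.

Lemma open_cell i j : open (cell i j).
Proof.
have -> : cell i j = (@fst R R @^-1` `]2 * i%:R, 2 * i%:R + 2[%classic) `&`
   (@snd R R @^-1` `]2 * j%:R, 2 * j%:R + 2[%classic).
  by rewrite eqEsubset; split => z [] /=; rewrite !in_itv /=.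
apply: openI; apply: open_comp => [z _|]; try exact: interval_open.
  exact: cvg_fst.
exact: cvg_snd.
Qed.

Lemma closed_closed_cell i j : closed (closed_cell i j).
Proof.
have -> : closed_cell i j = (@fst R R @^-1` `[2 * i%:R, 2 * i%:R + 2]%classic) `&`
   (@snd R R @^-1` `[2 * j%:R, 2 * j%:R + 2]%classic).
  by rewrite eqEsubset; split => z [] /=; rewrite !in_itv /=.
apply: closedI; apply: preimage_closed => [z _|]; try exact: interval_closed.
  exact: cvg_fst.
exact: cvg_snd.
Qed.

(** The boundary of the cell is drawn, so the open and the closed cell have the same trace on the
    face. This trace is open and closed in a connected set. *)
Lemma face_in_cell F i j z : is_face pos drawn F -> (i.+1 < K)%N -> (j.+1 < K)%N ->
  F z -> cell i j z -> F `<=` cell i j.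
Proof.
move=> [x [nx ->]] iK jK Fz Cz.
set F0 := connected_component _ x in Fz *.
have sub z' : F0 z' -> ~ ds z' by exact: connected_component_sub.
have E : F0 `&` cell i j = F0.
  apply: (@component_connected _ (~` ds) x).
  - by exists z.
  - by exists (cell i j) => //; exact: open_cell.
  - exists (closed_cell i j); first exact: closed_closed_cell.
    rewrite eqEsubset; split=> z' [Fz' [h1 h2]]; split=> //.
      by move: h1 h2 => /andP[? ?] /andP[? ?]; split; apply/andP; split; apply: ltW.
    by apply: closed_cell_undrawn => //; exact: sub.
by rewrite -E; exact: subIsetr.
Qed.

Definition inside : set (pt R) :=
  [set z | 0 < z.1 < 2 * K.-1%:R /\ 0 < z.2 < 2 * K.-1%:R].

Lemma open_inside : open inside.
Proof.
have -> : inside = (@fst R R @^-1` `]0, 2 * K.-1%:R[%classic) `&`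
   (@snd R R @^-1` `]0, 2 * K.-1%:R[%classic).
  by rewrite eqEsubset; split => z [] /=; rewrite !in_itv /=.
apply: openI; apply: open_comp => [z _|]; try exact: interval_open.
  exact: cvg_fst.
exact: cvg_snd.
Qed.

Lemma even_floor (x : R) (m : nat) : 0 < x < 2 * m%:R ->
  exists2 i, (i < m)%N & 2 * i%:R <= x <= 2 * i%:R + 2.
Proof.
elim: m => [|m IH] /andP[x0 xm]; first lra.
have [lt|ge] := ltP x (2 * m%:R).
  have [|i im ix] := IH; first by rewrite x0.
  by exists i => //; lia.
by exists m => //; rewrite ge /=; move: xm; rewrite -natr1; lra.
Qed.

(* The tracks of index [0] cover the lines of even abscissa or ordinate of the
   square [inside], so that each face meeting it is contained in a cell. *)
Lemma face_step F z z' : is_face pos drawn F -> inside z ->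
  closure F z -> closure F z' ->
  `|z'.1 - z.1| <= 2 /\ `|z'.2 - z.2| <= 2.
Proof.
move=> Ff zin Fz Fz'.
(* [z] itself may be drawn and lie on the border of several cells; a nearby point of the face
   selects the right one. *)
have [y [Fy [yin1 yin2]]] : (F `&` inside) !=set0.
  by apply: Fz; exact: open_nbhs_nbhs (conj open_inside zin).
have [i iK yi] := even_floor yin1; have [j jK yj] := even_floor yin2.
have iK' : (i.+1 < K)%N by nlia.
have jK' : (j.+1 < K)%N by nlia.
have ny : ~ ds y by case: Ff Fy => x [_ ->]; exact: connected_component_sub.
have Cy := closed_cell_undrawn iK' jK' (conj yi yj) ny.
have sub : closure F `<=` closed_cell i j.
  rewrite [X in _ `<=` X](closure_id _).1; last exact: closed_closed_cell.
  apply: closure_subset; apply: subset_trans (face_in_cell Ff iK' jK' Fy Cy) _.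
  move=> u [/andP[? ?] /andP[? ?]].
  by split; apply/andP; split; apply: ltW.
have [/andP[? ?] /andP[? ?]] := sub _ Fz.
have [/andP[? ?] /andP[? ?]] := sub _ Fz'.
by split; rewrite ler_norml; apply/andP; split; lra.
Qed.

(** Each face-vertex costs at most 2 in each coordinate. The margin [2 * q] around [u] ensures that
    every face is entered at a point of [inside], where [face_step] applies. *)
Lemma radial_walk_bound sigma (u v : pt R) len q (f : nat -> rnode R) :
  radial_walk pos drawn sigma u v len f ->
  2 * q%:R < u.1 < 2 * K.-1%:R - 2 * q%:R ->
  2 * q%:R < u.2 < 2 * K.-1%:R - 2 * q%:R ->
  (num_face_nodes len f <= q)%N ->
  `|v.1 - u.1| <= 2 * q%:R.
Proof.
move=> [f0 [flen step]] /andP[u1 u2] /andP[u3 u4] fq.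
pose c i := count (fun j => is_face_node (f j)) (iota 0 i.+1).
have cS i : c i.+1 = (c i + is_face_node (f i.+1))%N.
  by rewrite /c -addn1 iotaD count_cat /= addn0.
have c_le i : (i <= len)%N -> (c i <= q)%N.
  move=> il; apply: leq_trans fq; rewrite /c /num_face_nodes.
  rewrite -(subnKC il) -addSn iotaD count_cat; exact: leq_addr.
pose near (z : pt R) (b : R) := `|z.1 - u.1| <= b /\ `|z.2 - u.2| <= b.
(* A face is counted on entry but changes the coordinates only on exit; the point by which it is
   entered still satisfies the previous bound. *)
have inv i : (i <= len)%N -> match f i with
    | inl z => near z (2 * (c i)%:R)
    | inr F => exists2 z, closure F z & near z (2 * (c i)%:R - 2)
    end.
  elim: i => [|i IH] il.
    by rewrite f0 /near !subrr !normr0; split; apply: mulr_ge0.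
  have := IH (ltnW il); have := step i il; have := cS i; have := c_le _ il.
  case: (f i) (f i.+1) => [z|F] [z'|F'] //=.
    move=> cq cE [_ [Ff [Fz _]]] nz; exists z => //.
    by rewrite cE natrD; move: nz; rewrite /near => -[? ?]; split; lra.
  move=> cq cE [_ [Ff [Fz' _]]] [z Fz nz].
  have cq' : (c i)%:R <= q%:R :> R by rewrite ler_nat; lia.
  rewrite cE addn0; move: nz => -[].
  rewrite !ler_norml => /andP[n1 n2] /andP[n3 n4].
  have zin : inside z by split; apply/andP; split; lra.
  have [] := face_step Ff zin Fz Fz'; rewrite /near !ler_norml.
  by move=> /andP[? ?] /andP[? ?]; split; apply/andP; split; lra.
have := inv len (leqnn _); rewrite flen => -[h _]; apply: le_trans h _.
by rewrite ler_pM2l // ler_nat c_le.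
Qed.

End Drawing.

(** * Choice of the parameters *)

Lemma nat_sqrt_floor_sq k : (nat_sqrt_floor k * nat_sqrt_floor k <= k)%N.
Proof.
rewrite /nat_sqrt_floor; apply: (big_ind (fun s => s * s <= k)%N) => //.
by move=> s t; rewrite /maxn; case: ifP.
Qed.

Lemma rung_points (R : realType) p K Y X (a : nat -> R)
    (XK : forall t, (t < p)%N -> (X t < K)%N) (YK : (Y < K)%N) t (s : R) :
  drawn a (rung_edge XK YK t) s = ((2 * X t)%:R + s, (2 * Y)%:R + s).
Proof.
rewrite drawnE esrc_erk etgt_erk /posV /lerp /at_ /bx /by_ /nx /ny /side /=.
by rewrite !addn0 !natrD; congr pair; ring.
Qed.

Theorem mainTheorem14 (R : realType) (k p r : nat) :
  (0 < k)%N -> (0 < p)%N -> (0 < r)%N -> (p < 2 * nat_sqrt_floor k)%N ->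
  exists (n m : nat) (src tgt : 'I_m -> 'I_n)
         (pos : 'I_n -> pt R) (curve : 'I_m -> R -> pt R),
    simple_graph src tgt /\
    is_k_plane src tgt pos curve k /\
    exists T : {set 'I_m},
      unique_min_edge_cut src tgt T /\ #|T| = p /\
      forall sigma : 'I_m -> R, valid_subdivision curve sigma ->
        forall t1 t2, t1 \in T -> t2 \in T -> t1 != t2 ->
          face_dist_ge pos curve sigma
            (curve t1 (sigma t1)) (curve t2 (sigma t2)) r.
Proof.
move=> k0 p0 r0 ps; have sk := nat_sqrt_floor_sq k.
set s := nat_sqrt_floor k in ps sk.
have pk : (p * p <= 4 * k)%N.
  by have := leq_mul (ltnW ps) (ltnW ps); lia.
have [a [a0 amono aub agen]] := exists_generic_heights R p.+1.
(* For [p = 1] a single rung suffices, and [p + 1 <= k] may fail. *)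
pose K := (if p == 1 then 1 else (p + 1) * (r + 1) + 1)%N.
pose Y := (if p == 1 then 0 else r + 1)%N.
(* Rungs are [r + 1] cells apart and at least as far from the border. A walk through at most [r - 1]
   faces moves by at most [2 * (r - 1)], whereas two subdivision vertices differ by more than
   [2 * (r + 1) - 1], each being shifted by less than 1 along its rung. *)
pose X t := (if p == 1 then 0 else (t + 1) * (r + 1))%N.
have pk1 : (1 < K)%N -> (p.+1 <= k)%N.
  rewrite /K; have [//|p1 _] := eqVneq p 1%N.
  (* Then [p + 1 <= 2 * s <= s * s <= k]. *)
  have s2 : (2 <= s)%N by lia.
  by have := leq_mul s2 (leqnn s); lia.
have XK t : (t < p)%N -> (X t < K)%N.
  rewrite /X /K => tp; case: ifP => // _;
    have := leq_mul (_ : t + 1 <= p)%N (leqnn (r + 1)).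
  by move=> /(_ ltac:(lia)); lia.
have YK : (Y < K)%N by rewrite /Y /K; case: ifP => // _; nia.
have X_inj i j : (i < p)%N -> (j < p)%N -> X i = X j -> i = j.
  rewrite /X; case: ifP => [/eqP-> |_ _ _ /eqP]; first lia.
  by rewrite eqn_pmul2r ?addn1 // => /eqP; lia.
exists (nV p K), (nE p K Y X), (@src p K Y X), (@tgt p K Y X), (pos a),
  (@drawn R p K Y X a); split; first exact: simple_src_tgt.
split; first exact: drawn_k_plane.
exists (rungs XK YK); split; first exact: rungs_unique_min.
split; first exact: card_rungs.
move=> sigma sig _ _ /imsetP[i _ ->] /imsetP[j _ ->] ij len f walk _.
have nij : i != j by apply: contraNneq ij => ->.
have [/andP[i0 i1] _] := sig (rung_edge XK YK i).
have [/andP[j0 j1] _] := sig (rung_edge XK YK j).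
move: walk; rewrite !rung_points.
move: (sigma _) (sigma _) i0 i1 j0 j1 => sj si i0 i1 j0 j1 walk.
have p1 : p != 1%N.
  by apply: contraNneq nij => p1; apply/eqP/ord_inj; have := ltn_ord i;
    have := ltn_ord j; lia.
have XE t : X t = ((t + 1) * (r + 1))%N by rewrite /X (negbTE p1).
have YE : Y = (r + 1)%N by rewrite /Y (negbTE p1).
have KE : K.-1 = ((p + 1) * (r + 1))%N by rewrite /K (negbTE p1) addn1.
have cast (m n : nat) : (m + (r + 1) <= n)%N -> m%:R + r%:R + 1 <= n%:R :> R.
  by move=> h; rewrite -natrD natr1 ler_nat; lia.
have ip := ltn_ord i; have jp := ltn_ord j.
have Xlo : 0%:R + r%:R + 1 <= (X i)%:R :> R.
  by apply: cast; rewrite XE add0n leq_pmull ?addn1.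
have Xhi : (X i)%:R + r%:R + 1 <= K.-1%:R :> R.
  by apply: cast; rewrite XE KE -mulSnr leq_mul2r; nlia.
have Ylo : 0%:R + r%:R + 1 <= Y%:R :> R by apply: cast; rewrite YE.
have Yhi : Y%:R + r%:R + 1 <= K.-1%:R :> R.
  by apply: cast; rewrite YE KE -[X in (X + _)%N]mul1n -mulSnr leq_mul2r; nlia.
have sep : (X i)%:R + r%:R + 1 <= (X j)%:R :> R \/ (X j)%:R + r%:R + 1 <= (X i)%:R :> R.
  have [lt|gt|E] := ltngtP i j; last by case/eqP: nij; apply: ord_inj.
    by left; apply: cast; rewrite !XE -mulSnr leq_mul2r; nlia.
  by right; apply: cast; rewrite !XE -mulSnr leq_mul2r; nlia.
have rE : r.-1%:R + 1 = r%:R :> R by rewrite natr1 prednK.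
have r1 : 1 <= r%:R :> R by rewrite ler1n.
rewrite leqNgt; apply/negP => lt.
have lq : (num_face_nodes len f <= r.-1)%N by rewrite -ltnS prednK.
have := radial_walk_bound walk _ _ lq; rewrite /= !natrM ler_norml.
have b1 : 2 * r.-1%:R < 2 * (X i)%:R + si < 2 * K.-1%:R - 2 * r.-1%:R.
  by apply/andP; split; lra.
have b2 : 2 * r.-1%:R < 2 * Y%:R + si < 2 * K.-1%:R - 2 * r.-1%:R.
  by apply/andP; split; lra.
by move=> /(_ b1 b2) /andP[? ?]; case: sep => ?; lra.
Qed.
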